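(* Let a random open system, random observations $h_\omega$, thresholds $z_{\omega,N}$, scaling function $t$ and holes $H_{\omega,\epsilon_N}=\{x\in\mathcal J_{\omega,0}:h_\omega(x)>z_{\omega,N}\}$ be as in the context, and assume (C1'), (C2), (C3), (C4'), (C5'), (C7'), (C8) and (S). Then for $m$-a.e. $\omega\in\Omega$ $$\begin{aligned} &\lim_{N\to\infty}\nu_{\omega,0}\big(\{x\in\mathcal J_{\omega,0}:h_{\sigma^j\omega}(T_\omega^j(x))\le z_{\sigma^j\omega,N},\ j=0,\dots,N-1\}\big)\\ &\quad=\lim_{N\to\infty}\mu_{\omega,0}\big(\{x\in\mathcal J_{\omega,0}:h_{\sigma^j\omega}(T_\omega^j(x))\le z_{\sigma^j\omega,N},\ j=0,\dots,N-1\}\big)\\ &\quad=\exp\Big(-\int_\Omega t_\omega\theta_{\omega,0}\,dm(\omega)\Big), \end{aligned}$$ where $\theta_{\omega,0}=1-\sum_{k=0}^\infty\hat q_{\omega,0}^{(k)}$.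
   Context: **Closed system.** $(\Omega,\mathscr F,m)$ is a probability space, $\sigma:\Omega\to\Omega$ invertible, ergodic, $m$-preserving. $X$ is a complete metrisable space with Borel $\sigma$-algebra $\mathscr B$; $\omega\mapsto\mathcal J_{\omega,0}\subseteq X$ is a closed random set (closed-valued and measurable); $T_\omega:\mathcal J_{\omega,0}\to\mathcal J_{\sigma\omega,0}$, $T_\omega^n=T_{\sigma^{n-1}\omega}\circ\dots\circ T_\omega$; $\mathcal J_0=\bigcup_\omega\{\omega\}\times\mathcal J_{\omega,0}$, and $T(\omega,x)=(\sigma\omega,T_\omega x)$ is measurable on $\mathcal J_0$. A random (probability) measure on $\mathcal J_0$ is a measure with marginal $m$ on $\Omega$, identified with its disintegration into fibre (probability) measures. $\mathcal B_\omega\subseteq L^\infty(\nu_{\omega,0})$ ($\nu_{\omega,0}$ below) is a Banach space of real functions on $\mathcal J_{\omega,0}$; $\|\cdot\|_{\infty,\omega}$ is the $L^\infty(\nu_{\omega,0})$ norm; $\mathcal B$ is the set of $f:\mathcal J_0\to\mathbb R$ with $f_\omega=f(\omega,\cdot)\in\mathcal B_\omega$ for all $\omega$. For a potential $\varphi_0:\mathcal J_0\to\mathbb R$ with $g_{\omega,0}=e^{\varphi_{\omega,0}}\in\mathcal B_\omega$, the transfer operator $\mathcal L_{\omega,0}f(x)=\sum_{y\in T_\omega^{-1}(x)}f(y)g_{\omega,0}(y)$ is well defined $\mathcal B_\omega\to\mathcal B_{\sigma\omega}$, and $(\omega,x)\mapsto\mathcal L_{\sigma^{-1}\omega,0}f_{\sigma^{-1}\omega}(x)$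 is measurable for measurable $f\in\mathcal B$. There are a random probability measure $\nu_0=\{\nu_{\omega,0}\}$ on $\mathcal J_0$ with non-atomic fibres, measurable $\lambda_0:\Omega\to\mathbb R\setminus\{0\}$ and measurable $\phi_0\in\mathcal B$, $\phi_0>0$, with $\mathcal L_{\omega,0}\phi_{\omega,0}=\lambda_{\omega,0}\phi_{\sigma\omega,0}$, $\nu_{\sigma\omega,0}(\mathcal L_{\omega,0}f)=\lambda_{\omega,0}\nu_{\omega,0}(f)$ for $f\in\mathcal B_\omega$, $\lambda_{\omega,0}=\nu_{\sigma\omega,0}(\mathcal L_{\omega,0}\mathbf 1)$, $\log\lambda_{\omega,0}\in L^1(m)$; $\mu_{\omega,0}:=\phi_{\omega,0}\nu_{\omega,0}$ defines a $T$-invariant random probability measure $\mu_0$. **Observations, thresholds, holes.** For each $\omega$, $h_\omega:\mathcal J_{\omega,0}\to\mathbb R$ is continuous, with essential supremum $\overline z_\omega$ and essential infimum $\underline z_\omega$ with respect to $\nu_{\omega,0}$; $\underline z_\omega<\overline z_\omega$ for $m$-a.e. $\omega$ and $\nu_{\omega,0}(\{h_\omega>\overline z_\omega\})=0$. For each $\omega$, $(z_{\omega,N})_N$ is an increasing sequence in $[\underline z_\omega,\overline z_\omega]$. The holes are $H_{\omega,\epsilon_N}=\{x\in\mathcal J_{\omega,0}:h_\omega(x)-z_{\omega,N}>0\}$, a decreasing sequence; $\epsilon_N$ is merely an index label. Below, $\epsilon$ ranges over $\{0\}\cup\{\epsilon_N:N\ge1\}$, ''$\epsilon\to0$'' means $N\to\infty$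 and ''$\epsilon>0$ sufficiently small'' means $N$ sufficiently large. **Open systems.** $H_\epsilon=\bigcup_\omega\{\omega\}\times H_{\omega,\epsilon}\subseteq\mathcal J_0$ is measurable, $0<\nu_0(H_\epsilon)<1$; $\mathcal J_{\omega,\epsilon}=\mathcal J_{\omega,0}\setminus H_{\omega,\epsilon}$, $X_{\omega,\infty,\epsilon}=\{x\in\mathcal J_{\omega,0}:T_\omega^jx\notin H_{\sigma^j\omega,\epsilon}\ \forall j\ge0\}$. $\mathcal L_{\omega,\epsilon}f=\mathcal L_{\omega,0}(\mathbf 1_{\mathcal J_{\omega,\epsilon}}f)$ maps $\mathcal B_\omega$ to $\mathcal B_{\sigma\omega}$; $\mathcal L^n_{\omega,\epsilon}$, $Q^n_{\omega,\epsilon}$ denote compositions along the $\sigma$-orbit. For $m$-a.e. $\omega$, $X_{\omega,\infty,\epsilon}\neq\emptyset$ and $\bigcap_n\{x:\mathcal L^n_{\sigma^{-n}\omega,\epsilon}\mathbf 1(x)\ne0\}\neq\emptyset$. $\Omega_+$ is the set of $\omega$ with $\mu_{\omega,0}(H_{\omega,\epsilon})>0$ for all $\epsilon>0$. For $k\ge0$, $$\hat q_{\omega,\epsilon}^{(k)}=\frac{\mu_{\sigma^{-(k+1)}\omega,0}\Big(T_{\sigma^{-(k+1)}\omega}^{-(k+1)}(H_{\omega,\epsilon})\cap\bigcap_{j=1}^kT_{\sigma^{-(k+1)}\omega}^{-(k+1)+j}(H^c_{\sigma^{-j}\omega,\epsilon})\cap H_{\sigma^{-(k+1)}\omega,\epsilon}\Big)}{\mu_{\sigma^{-(k+1)}\omega,0}\big(T_{\sigma^{-(k+1)}\omega}^{-(k+1)}(H_{\omega,\epsilon})\big)}.$$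 **Assumptions.** (C1') There is $C_1\ge1$ with $C_1^{-1}\le\mathcal L_{\omega,0}\mathbf 1\le C_1$ for $m$-a.e. $\omega$. (C2) For each $\epsilon\ge0$ there are a random measure $\{\nu_{\omega,\epsilon}\}$ supported in $\mathcal J_0$ and measurable $\lambda_\epsilon:\Omega\to(0,\infty)$ with $\log\lambda_{\omega,\epsilon}\in L^1(m)$, $\phi_\epsilon:\mathcal J_0\to\mathbb R$ with $\mathcal L_{\omega,\epsilon}\phi_{\omega,\epsilon}=\lambda_{\omega,\epsilon}\phi_{\sigma\omega,\epsilon}$, $\nu_{\sigma\omega,\epsilon}(\mathcal L_{\omega,\epsilon}f)=\lambda_{\omega,\epsilon}\nu_{\omega,\epsilon}(f)$ for $f\in\mathcal B_\omega$; for $m$-a.e. $\omega$, $\nu_{\omega,0}(\phi_{\omega,\epsilon})=1$ and $\nu_{\omega,0}(\mathbf 1)=1$ (for $\epsilon=0$ these are the closed objects). (C3) There is $Q_{\omega,\epsilon}:\mathcal B_\omega\to\mathcal B_{\sigma\omega}$ with, for $m$-a.e. $\omega$ and $f\in\mathcal B_\omega$, $\lambda_{\omega,\epsilon}^{-1}\mathcal L_{\omega,\epsilon}f=\nu_{\omega,\epsilon}(f)\phi_{\sigma\omega,\epsilon}+Q_{\omega,\epsilon}f$, $Q_{\omega,\epsilon}\phi_{\omega,\epsilon}=0$, $\nu_{\sigma\omega,\epsilon}(Q_{\omega,\epsilon}f)=0$. (C4') For each $f\in\mathcal B$ and $N\in\mathbb N$ there are $C_f>0$ and $\alpha(N)>0$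 (independent of $\omega$) with $\sum_{N\ge1}\alpha(N)<\infty$ such that for $m$-a.e. $\omega$ and all $N$, $\sup_{\epsilon\ge0}\|Q^N_{\omega,\epsilon}f_\omega\|_{\infty,\sigma^N\omega}\le C_f\alpha(N)\|f_\omega\|_{\mathcal B_\omega}$. (C5') There is $C_2\ge1$ with $\sup_{\epsilon\ge0}\|\phi_{\omega,\epsilon}\|_{\infty,\omega}\le C_2$ and $\|\phi_{\omega,0}\|_{\mathcal B_\omega}\le C_2$ for $m$-a.e. $\omega$. (C7') There is $C_3\ge1$ such that for all sufficiently small $\epsilon>0$, $\operatorname{ess\,inf}_\omega\inf\phi_{\omega,0}\ge C_3^{-1}>0$ and $\operatorname{ess\,inf}_\omega\inf\phi_{\omega,\epsilon}\ge0$. (C8) For $m$-a.e. $\omega\in\Omega_+$ the limit $\hat q_{\omega,0}^{(k)}:=\lim_{\epsilon\to0}\hat q_{\omega,\epsilon}^{(k)}$ exists for each $k\ge0$. (S) $t\in L^\infty(m)$ with $t>0$ is a fixed random scaling function, and $z_N,\xi_N\in L^\infty(m)$ and $W<\infty$ satisfy $\mu_{\omega,0}(\{h_\omega(x)-z_{\omega,N}>0\})=(t_\omega+\xi_{\omega,N})/N$ for a.e. $\omega$ and each $N\ge1$, where $\lim_{N\to\infty}\xi_{\omega,N}=0$ for a.e. $\omega$ and $|\xi_{\omega,N}|\le W$ for a.e. $\omega$ and all $N\ge1$.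
   Formalization: The conformality identity ν_{σω,0}(L_{ω,0}f)=λ_{ω,0}ν_{ω,0}(f) is required for all products 1_A f with A Borel and f in B_ω, not only for f in B_ω; if B_ω is too poor to determine measures, the claim as stated fails. *)

(* Defs.v *)
From HB Require Import structures.
From mathcomp Require Import all_boot all_order all_algebra.
From mathcomp Require Import all_classical all_reals all_analysis.
From mathcomp Require Import measurable_realfun ess_sup_inf.

Set Implicit Arguments.
Unset Strict Implicit.
Unset Printing Implicit Defensive.

Import Order.TTheory GRing.Theory Num.Theory.
Import numFieldNormedType.Exports.

Local Open Scope classical_set_scope.
Local Open Scope ring_scope.

#[short(type="completeMetricType")]
HB.structure Definition CompleteMetric (K : numDomainType) :=
  {T of Metric K T & Complete T}.

Notation borel X := (g_sigma_algebraType (@open X)).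

(** [f] is measurable for the trace sigma-algebra on [D].  Unlike
    [measurable_fun D f], this is not vacuous when [D] itself is not
    measurable: [X] is not assumed separable, so the graph of a closed random
    set need not belong to the product sigma-algebra. *)
Definition trace_measurable_fun d d' (T : measurableType d)
    (U : measurableType d') (D : set T) (f : T -> U) : Prop :=
  forall Y, measurable Y ->
    exists2 A : set T, measurable A & D `&` f @^-1` Y = D `&` A.

Definition measure_preserving d (T : measurableType d) (R : realType)
    (m : probability T R) (s : T -> T) : Prop :=
  measurable_fun setT s /\ forall A, measurable A -> m (s @^-1` A) = m A.

Definition ergodic d (T : measurableType d) (R : realType)
    (m : probability T R) (s : T -> T) : Prop :=
  forall A, measurable A -> s @^-1` A = A -> m A = 0%E \/ m A = 1%E.

Definition non_atomic d (T : measurableType d) (R : realType)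
    (mu : {measure set T -> \bar R}) : Prop :=
  forall A, measurable A -> (0 < mu A)%E ->
    exists B, [/\ measurable B, B `<=` A & (0 < mu B < mu A)%E].

Definition closed_random_set d (Omega : measurableType d) (R : realType)
    (X : completeMetricType R) (J : Omega -> set X) : Prop :=
  (forall w, closed (J w)) /\
  forall x : X, measurable_fun setT
    ((fun w => ereal_inf [set (mdist x y)%:E | y in J w]) : Omega -> \bar R).

(** Unordered sum of a real function over a set; meaningful when
    [summable D (EFin \o F)]. *)
Definition set_sum (T : choiceType) (R : realType) (D : set T) (F : T -> R) : R :=
  fine (esum D (EFin \o F)^\+%E) - fine (esum D (EFin \o F)^\-%E).

(** The random open system.

    The index [N : nat] plays the role of [epsilon]: [N = 0] is the closed
    system [epsilon = 0] and [N >= 1] is [epsilon = epsilon_N]; hence "for all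
    epsilon >= 0" is "for all N", and "epsilon -> 0" is "N -> oo".  The value
    [thr w 0] is never used.

    Maps and functions on a fibre [J w] are given by total maps on [X] of which
    only the values on [J w] are relevant.

    The space [B w] is an abstract Banach space together with the evaluation
    [ev w] of its elements as functions (injective on [J w], see
    [closed_system]); a function [f] on the bundle of all [J w] with
    [f_w \in B_w] for all [w] is an element of [forall w, B w]. *)
Record open_system d (Omega : measurableType d) (R : realType)
    (X : completeMetricType R) := OpenSystem {
  sigma : Omega -> Omega ;
  sigmaV : Omega -> Omega ;
  J : Omega -> set X ;
  T : Omega -> X -> X ;
  B : Omega -> completeNormedModType R ;
  ev : forall w, B w -> X -> R ;
  one : forall w, B w ;
  pot : Omega -> X -> R ;
  L : nat -> forall w, B w -> B (sigma w) ;
  nu : nat -> R.-ker Omega ~> borel X ;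
  lambda : nat -> Omega -> R ;
  phi : nat -> forall w, B w ;
  obs : Omega -> X -> R ;
  thr : Omega -> nat -> R }.

Arguments ev {d Omega R X} o {w} f x.
Arguments L {d Omega R X} o N w f.

Section definitions.
Context d (Omega : measurableType d) (R : realType) (m : probability Omega R).
Context (X : completeMetricType R) (S : open_system Omega X).

Local Notation sigma := (sigma S).
Local Notation sigmaV := (sigmaV S).
Local Notation J := (J S).
Local Notation T := (T S).
Local Notation B := (B S).
Local Notation ev := (ev S).
Local Notation one := (one S).
Local Notation pot := (pot S).
Local Notation L := (L S).
Local Notation nu := (nu S).
Local Notation lambda := (lambda S).
Local Notation phi := (phi S).
Local Notation obs := (obs S).
Local Notation thr := (thr S).

Definition total_space : set (Omega * borel X) := [set p | J p.1 p.2].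

Fixpoint T_iter (n : nat) (w : Omega) (x : X) : X :=
  if n is k.+1 then T (iter k sigma w) (T_iter k w x) else x.

Fixpoint op_iter (P : forall w, B w -> B (sigma w)) (n : nat) (w : Omega) :
    B w -> B (iter n sigma w) :=
  if n is k.+1 then fun f => P (iter k sigma w) (op_iter P k f) else id.

Definition hole (N : nat) (w : Omega) : set X :=
  if N is 0 then set0 else [set x | J w x /\ obs w x - thr w N > 0].

Definition survivor (N : nat) (w : Omega) : set X :=
  [set x | J w x /\ forall j, ~ hole N (iter j sigma w) (T_iter j w x)].

Definition preimage_pt (w : Omega) (x : X) : set X :=
  [set y | J w y /\ T w y = x].

Definition transfer (w : Omega) (f : X -> R) (x : X) : R :=
  set_sum (preimage_pt w x) (fun y => f y * expR (pot w y)).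

Definition nu_int (N : nat) (w : Omega) (f : B w) : R :=
  \int[nu N w]_(x in J w) ev f x.

Definition sup_norm (w : Omega) (f : B w) : \bar R :=
  ('N[nu 0 w]_+oo[EFin \o ev f])%E.

Definition mu (w : Omega) (A : set X) : \bar R :=
  (\int[nu 0 w]_(x in (A `&` J w : set (borel X))) (ev (phi 0 w) x)%:E)%E.

Definition bundle_measurable (f : forall w, B w) : Prop :=
  trace_measurable_fun total_space (fun p => ev (f p.1) p.2 : R).

Record closed_system : Prop := {
  cs_sigmaK : cancel sigma sigmaV ;
  cs_sigmaVK : cancel sigmaV sigma ;
  cs_sigma_mp : measure_preserving m sigma ;
  cs_sigmaV_meas : measurable_fun setT sigmaV ;
  cs_ergodic : ergodic m sigma ;
  cs_J : closed_random_set J ;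
  cs_T_J : forall w x, J w x -> J (sigma w) (T w x) ;
  cs_T_meas : trace_measurable_fun total_space
    (fun p => (sigma p.1, T p.1 p.2) : Omega * borel X) ;
  cs_ev_lin : forall w (a : R) (f g : B w) x, J w x ->
    ev (a *: f + g) x = a * ev f x + ev g x ;
  cs_ev_inj : forall w (f g : B w),
    (forall x, J w x -> ev f x = ev g x) -> f = g ;
  cs_ev_Linfty : forall w (f : B w),
    ((ev f \_ (J w) : borel X -> R) \in Lfun (nu 0 w) +oo%E) ;
  cs_one : forall w x, J w x -> ev (one w) x = 1 ;
  cs_g : forall w, exists g : B w, forall x, J w x -> ev g x = expR (pot w x) ;
  cs_L_wd : forall w (f : B w) x, J (sigma w) x ->
    summable (preimage_pt w x) (fun y => (ev f y * expR (pot w y))%:E) ;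
  cs_L : forall w (f : B w) x, J (sigma w) x ->
    ev (L 0 w f) x = transfer w (ev f) x ;
  cs_L_meas : forall f : (forall w, B w), bundle_measurable f ->
    trace_measurable_fun total_space
      (fun p => ev (L 0 (sigmaV p.1) (f (sigmaV p.1))) p.2 : R) ;
  cs_nu_prob : forall w, nu 0 w (J w) = 1%E /\ nu 0 w (~` J w) = 0%E ;
  cs_nu_non_atomic : forall w, non_atomic (nu 0 w) ;
  cs_lambda_meas : measurable_fun setT (lambda 0) ;
  cs_lambda_neq0 : forall w, lambda 0 w != 0 ;
  cs_log_lambda : m.-integrable setT (fun w => (ln (lambda 0 w))%:E) ;
  cs_phi_meas : bundle_measurable (phi 0) ;
  cs_phi_gt0 : forall w x, J w x -> 0 < ev (phi 0 w) x ;
  cs_phi : forall w, L 0 w (phi 0 w) = lambda 0 w *: phi 0 (sigma w) ;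
  (* [B w] need not be closed under multiplication by indicators nor be rich
     enough to determine measures, so that the identity on [B w] (the case
     [A = setT]) does not by itself express
     [L_{w,0}^* nu_{sigma w,0} = lambda_{w,0} nu_{w,0}]; conformality of [nu 0]
     is therefore required for the functions [1_A f] as well. *)
  cs_conformal : forall w (f : B w) (A : set (borel X)), measurable A ->
    \int[nu 0 (sigma w)]_(x in J (sigma w))
        transfer w (fun y => \1_A y * ev f y) x =
    lambda 0 w * \int[nu 0 w]_(x in A `&` J w) ev f x ;
  cs_lambda : forall w, lambda 0 w = nu_int 0 (L 0 w (one w)) ;
  cs_mu_prob : forall w, mu w setT = 1%E ;
  cs_mu_inv : forall A : set (Omega * borel X), measurable A ->
    (\int[m]_w mu w [set x | J w x /\ A (sigma w, T w x)] =
     \int[m]_w mu w [set x | J w x /\ A (w, x)])%E }.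

(* Essential bounds over [J w]: its complement is [nu 0 w]-null. *)
Definition ess_sup_obs (w : Omega) : \bar R :=
  ess_sup (nu 0 w) (EFin \o obs w : borel X -> \bar R).

Definition ess_inf_obs (w : Omega) : \bar R :=
  ess_inf (nu 0 w) (EFin \o obs w : borel X -> \bar R).

Record observations : Prop := {
  ob_cont : forall w, {within J w, continuous (obs w)} ;
  ob_nontrivial : \forall w \ae m, (ess_inf_obs w < ess_sup_obs w)%E ;
  ob_le_sup : forall w,
    nu 0 w [set x | J w x /\ (ess_sup_obs w < (obs w x)%:E)%E] = 0%E ;
  ob_thr : forall w N, (0 < N)%N ->
    (ess_inf_obs w <= (thr w N)%:E <= ess_sup_obs w)%E ;
  ob_thr_incr : forall w M N, (0 < M)%N -> (M <= N)%N -> thr w M <= thr w N }.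

Record open_holes : Prop := {
  oh_meas : forall N, (0 < N)%N ->
    exists2 A : set (Omega * borel X), measurable A &
      [set p | hole N p.1 p.2] = total_space `&` A ;
  oh_nu : forall N, (0 < N)%N ->
    (0 < \int[m]_w nu 0 w (hole N w) < 1)%E ;
  oh_L : forall N w (f : B w) x, (0 < N)%N -> J (sigma w) x ->
    ev (L N w f) x = transfer w (fun y => \1_(J w `\` hole N w) y * ev f y) x ;
  oh_survivor : forall N, (0 < N)%N -> \forall w \ae m, survivor N w !=set0 ;
  oh_support : forall N, (0 < N)%N -> \forall w \ae m,
    (\bigcap_n [set x | J w x /\
       ev (op_iter (L N) n (one (iter n sigmaV w))) x != 0]) !=set0 }.

Definition Omega_plus : set Omega :=
  [set w | forall N, (0 < N)%N -> (0 < mu w (hole N w))%E].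

(* [w'] is [sigma^{-(k+1)} w]; the preimages under powers of [T] of the
   complements of the holes are taken inside [J w']. *)
Definition qhat (k N : nat) (w : Omega) : R :=
  let w' := iter k.+1 sigmaV w in
  fine (mu w' [set x | [/\ J w' x, hole N w (T_iter k.+1 w' x),
      forall j, (1 <= j <= k)%N ->
        ~ hole N (iter j sigmaV w) (T_iter (k.+1 - j) w' x)
      & hole N w' x]]) /
  fine (mu w' [set x | J w' x /\ hole N w (T_iter k.+1 w' x)]).

Definition qhat0 (k : nat) (w : Omega) : R := limn (fun N => qhat k N w).

Definition theta0 (w : Omega) : R := 1 - limn (series (fun k => qhat0 k w)).

Definition C1' : Prop := exists2 K : R, 1 <= K &
  \forall w \ae m, forall x, J (sigma w) x ->
    K^-1 <= ev (L 0 w (one w)) x <= K.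

(* For N >= 1 the fibres [nu N w] are finite but not normalised; integrability
   of the elements of [B w] is what gives a meaning to [nu_{w,eps}(f)]. *)
Record C2_at (N : nat) : Prop := {
  c2_supp : \forall w \ae m,
    nu N w (~` J w) = 0%E /\ (nu N w setT < +oo)%E ;
  c2_integrable : \forall w \ae m, forall f : B w,
    (nu N w).-integrable (J w) (EFin \o ev f) ;
  c2_lambda_meas : measurable_fun setT (lambda N) ;
  c2_lambda_gt0 : forall w, 0 < lambda N w ;
  c2_log_lambda : m.-integrable setT (fun w => (ln (lambda N w))%:E) ;
  c2_phi_meas : bundle_measurable (phi N) ;
  c2_phi : \forall w \ae m,
    L N w (phi N w) = lambda N w *: phi N (sigma w) ;
  c2_nu : \forall w \ae m, forall f : B w,
    nu_int N (L N w f) = lambda N w * nu_int N f ;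
  c2_normal : \forall w \ae m,
    nu_int 0 (phi N w) = 1 /\ nu_int 0 (one w) = 1 }.

Definition C2 : Prop := forall N, C2_at N.

Definition C3 (Q : nat -> forall w, B w -> B (sigma w)) : Prop :=
  forall N, \forall w \ae m, forall f : B w,
    [/\ (lambda N w)^-1 *: L N w f = nu_int N f *: phi N (sigma w) + Q N w f,
        Q N w (phi N w) = 0 & nu_int N (Q N w f) = 0].

Definition C4' (Q : nat -> forall w, B w -> B (sigma w)) : Prop :=
  forall f : (forall w, B w), exists Cf : R, exists alpha : nat -> R,
    [/\ 0 < Cf, forall n, (0 < n)%N -> 0 < alpha n,
        cvgn (series alpha) &
        \forall w \ae m, forall n N, (0 < n)%N ->
          (sup_norm (op_iter (Q N) n (f w)) <=
             (Cf * alpha n * `|f w|)%:E)%E].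

Definition C5' : Prop := exists2 K : R, 1 <= K &
  \forall w \ae m,
    (forall N, (sup_norm (phi N w) <= K%:E)%E) /\ `|phi 0 w| <= K.

Definition ess_inf_inf (N : nat) : \bar R :=
  ess_inf m (fun w => ereal_inf [set (ev (phi N w) x)%:E | x in J w]).

Definition C7' : Prop := exists2 K : R, 1 <= K &
  \forall N \near \oo,
    ((K^-1)%:E <= ess_inf_inf 0)%E /\ (0 <= ess_inf_inf N)%E.

Definition C8 : Prop := \forall w \ae m, Omega_plus w ->
  forall k, cvgn (fun N => qhat k N w).

Record scaling (t : Omega -> R) (xi : nat -> Omega -> R) : Prop := {
  sc_t : t \in Lfun m +oo%E ;
  sc_t_gt0 : \forall w \ae m, 0 < t w ;
  sc_thr : forall N, (0 < N)%N -> (thr^~ N) \in Lfun m +oo%E ;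
  sc_xi : forall N, (0 < N)%N -> xi N \in Lfun m +oo%E ;
  sc_mu : \forall w \ae m, forall N, (0 < N)%N ->
    mu w [set x | J w x /\ obs w x - thr w N > 0] =
      ((t w + xi N w) / N%:R)%:E ;
  sc_xi_cvg : \forall w \ae m, xi^~ w @ \oo --> (0 : R) ;
  sc_xi_bound : exists W : R, \forall w \ae m, forall N, (0 < N)%N ->
    `|xi N w| <= W }.

Definition below_threshold (N : nat) (w : Omega) : set X :=
  [set x | J w x /\ forall j, (j < N)%N ->
     obs (iter j sigma w) (T_iter j w x) <= thr (iter j sigma w) N].

End definitions.

(* Main.v *)
Require Import Defs.
From HB Require Import structures.
From mathcomp Require Import all_boot all_order all_algebra.
From mathcomp Require Import all_classical all_reals all_analysis.
From mathcomp Require Import measurable_realfun ess_sup_inf.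
From mathcomp Require Import ring lra.

Set Implicit Arguments.
Unset Strict Implicit.
Unset Printing Implicit Defensive.

Import Order.TTheory GRing.Theory Num.Theory.
Import numFieldNormedType.Exports.

Local Open Scope classical_set_scope.
Local Open Scope ring_scope.

(** Write [L_N], [lambda_N], [phi_N] for the operator, eigenvalue and
    eigenfunction with the hole [H_N]. The argument has two halves.

    Perturbation. Conformality of [nu_0] gives
    [lambda_N / lambda_0 = 1 - e_N] with [e_N(w) = int_{H_N} phi_N dnu_{w,0}]
    ([escapeE]). Applying the spectral decomposition [C3] along the orbit from
    [sigma^-n w] to [w], to [phi_0], and integrating over [H_N], the main term
    is the [mu]-mass of the points that start over [sigma^-n w], avoid the
    holes for [n] steps and are then in [H_N]. Splitting the points that are in
    [H_N] at time [n] by their last earlier visit to a hole, and using the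
    invariance of [mu], one finds for this mass
    [mu_w(H_N) (1 - sum_(k < n) qhat_N^(k)(w))] ([survivor_phi]), while the
    remainder is at most a constant times [alpha(n) mu_w(H_N)]
    ([escape_expansion]). Let [N -> oo] and then [n -> oo]:
    [e_N(w) / mu_w(H_N) -> theta_0(w)] ([cvg_escape_ratio]); with the scaling
    of the holes, [N e_N -> t theta_0] almost everywhere.

    Limit law. The same decomposition over [N] steps from [w] shows that the
    [nu_0]-mass of the points that avoid the holes up to time [N] is
    [prod_(j < N) (1 - e_N(sigma^j w))] times a factor tending to [1]
    ([survivor_fint_eq]). As [e_N = O(1/N)] uniformly, the product behaves
    like the exponential of [- sum_(j < N) e_N(sigma^j w)] ([cvg_prod_expR]).
    This sum is an ergodic average of functions [N e_N] that vary with [N];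
    a version of the ergodic theorem for bounded, almost everywhere convergent
    sequences ([birkhoff_seq_ae]) identifies its limit as [int t theta_0 dm].
    The mass for [mu] is treated in the same way, with [phi_0] in place of
    the constant [1].

    The decomposition is used after integration over a Borel set
    ([Q_iter_fint]), where conformality turns [L_N] into the preimage map
    [pullback1] on sets. *)

(** * Integrals of almost everywhere equal functions *)

Section ae_integral.
Context (R : realType) (d : measure_display) (Omega : measurableType d).
Context (m : {measure set Omega -> \bar R}).

Import HBNNSimple.

(** Only [f] is measurable: [theta0] is defined by pointwise limits that exist
    almost everywhere, so it is only known to agree with a measurable function
    almost everywhere. Both inequalities come from modifying the simple
    functions below [f] or [g] on a null set. *)
Lemma ge0_integral_ae_eq (f g : Omega -> \bar R) :
  (forall w, 0 <= f w)%E -> (forall w, 0 <= g w)%E ->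
  measurable_fun setT f -> (\forall w \ae m, f w = g w) ->
  (\int[m]_w f w = \int[m]_w g w)%E.
Proof.
move=> f0 g0 mf [A [mA A0 fgA]].
have fg w : ~ A w -> f w = g w by move=> nA; apply: contrapT => ?; exact/nA/fgA.
apply/eqP; rewrite eq_le; apply/andP; split.
  rewrite (@ge0_negligible_integral _ _ _ m setT A f) ?setTD//.
  rewrite integral_mkcond; rewrite !ge0_integralTE//; last first.
    by move=> w; rewrite patchE; case: ifP.
  apply: le_ereal_sup => _ /= [h hf <-]; exists h => // w.
  rewrite (le_trans (hf w))// patchE; case: ifP => //.
  by rewrite inE /= => /fg ->.
rewrite [leLHS]ge0_integralTE//; apply: ge_ereal_sup => _ /= [h hg <-].
rewrite -integralT_nnsfun.
have mh : measurable_fun setT (EFin \o h) by exact/measurable_EFinP.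
rewrite (@ge0_negligible_integral _ _ _ m setT A f) ?setTD//.
rewrite (@ge0_negligible_integral _ _ _ m setT A (EFin \o h)) ?setTD//.
- apply: ge0_le_integral => //.
  + exact: measurableC.
  + by move=> w _; rewrite lee_fin.
  + exact: measurable_funS mh.
  + exact: measurable_funS mf.
  + by move=> w /= nA; rewrite fg.
- by move=> w _; rewrite lee_fin.
Qed.

Lemma ae_eq_Rintegral (f g : Omega -> R) :
  measurable_fun setT f -> (\forall w \ae m, f w = g w) ->
  \int[m]_w f w = \int[m]_w g w.
Proof.
move=> mf fg; rewrite /Rintegral; congr fine; rewrite [LHS]integralE [RHS]integralE.
congr (_ - _)%E; apply: ge0_integral_ae_eq.
- by move=> w; exact: funepos_ge0.
- by move=> w; exact: funepos_ge0.
- by apply: measurable_funepos; exact/measurable_EFinP.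
- by apply: filterS fg => w; rewrite !funeposE => ->.
- by move=> w; exact: funeneg_ge0.
- by move=> w; exact: funeneg_ge0.
- by apply: measurable_funeneg; exact/measurable_EFinP.
- by apply: filterS fg => w; rewrite !funenegE => ->.
Qed.

End ae_integral.

(** * The ergodic theorem for bounded sequences of functions *)

Section ergodic_theorem.
Context (R : realType) (d : measure_display) (Omega : measurableType d).
Context (m : probability Omega R) (s : Omega -> Omega).
Implicit Types (f : Omega -> R) (K c : R) (w : Omega).

Definition bounded_measurable f :=
  measurable_fun setT f /\ exists K, forall w, `|f w| <= K.

Lemma measurable_gt_fun f c : measurable_fun setT f ->
  measurable [set w | c < f w].
Proof.
move=> mf; rewrite (_ : [set _ | _] = f @^-1` `]c, +oo[); last first.
  by apply/seteqP; split => w; rewrite /= in_itv/= andbT.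
by rewrite -[X in measurable X]setTI; exact: mf.
Qed.

Lemma bounded_measurable_integrable f (A : set Omega) : measurable A ->
  bounded_measurable f -> m.-integrable A (EFin \o f).
Proof.
move=> mA [mf [K fK]]; apply: measurable_bounded_integrable => //.
- by rewrite (le_lt_trans (probability_le1 m mA)) ?ltry.
- exact: measurable_funS mf.
- by exists K; split; rewrite ?num_real// => M KM w _; exact: le_trans (fK w) (ltW KM).
Qed.

Lemma bounded_measurableD f g : bounded_measurable f -> bounded_measurable g ->
  bounded_measurable (fun w => f w + g w).
Proof.
move=> [mf [K fK]] [mg [L gL]]; split; first exact: measurable_funD.
exists (K + L) => w; rewrite (le_trans (ler_normD _ _))//; exact: lerD.
Qed.

Lemma cvg_Rintegral_bounded (f_ : nat -> Omega -> R) f K :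
  (forall n, measurable_fun setT (f_ n)) -> (forall n w, `|f_ n w| <= K) ->
  measurable_fun setT f -> (\forall w \ae m, f_ ^~ w @ \oo --> f w) ->
  m.-integrable setT (EFin \o f) /\
  \int[m]_w f_ n w @[n --> \oo] --> \int[m]_w f w.
Proof.
move=> mf_ fK mf f_f.
have [|||||intf _ cv] := @dominated_convergence _ _ _ m _ measurableT
  (fun n => EFin \o f_ n) (EFin \o f) (fun=> K%:E).
- by move=> n; exact/measurable_EFinP.
- exact/measurable_EFinP.
- by apply: filterS f_f => w ? _; apply: cvg_EFin => //; exact: nearW.
- apply: (@bounded_measurable_integrable (fun=> K)) => //.
  by split => //; exists `|K|.
- by apply: nearW => w n _ /=; rewrite lee_fin.
split=> //; apply: fine_cvg; rewrite fineK//.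
exact: integrable_fin_num.
Qed.

Hypothesis s_mp : measure_preserving m s.

Lemma ae_measure_preserving (P : Omega -> Prop) :
  (\forall w \ae m, P w) -> \forall w \ae m, P (s w).
Proof.
case: s_mp => ms mps [A [mA A0 PA]]; exists (s @^-1` A); split.
- by rewrite -[X in measurable X]setTI; exact: ms.
- by rewrite mps.
- by move=> w /= nP; exact: PA.
Qed.

Lemma ae_iter (P : Omega -> Prop) : (\forall w \ae m, P w) ->
  \forall w \ae m, forall n, P (iter n s w).
Proof.
move=> hP; apply/ae_foralln => n; elim: n => //= n /ae_measure_preserving.
by apply: filterS => w; rewrite -iterS iterSr.
Qed.

Lemma bounded_measurable_comp f : bounded_measurable f ->
  bounded_measurable (f \o s).
Proof.
case: s_mp => ms _ [mf [K fK]]; split; first exact: measurableT_comp.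
by exists K => w /=.
Qed.

Lemma Rintegral_measure_preserving f : bounded_measurable f ->
  \int[m]_w f (s w) = \int[m]_w f w.
Proof.
move=> bf; case: (s_mp) => ms mps; congr fine.
have [mf _] := bf.
transitivity (\int[pushforward m s]_w (f w)%:E)%E.
  rewrite (integral_pushforward ms) ?preimage_setT//.
    exact/measurable_EFinP.
  exact: (bounded_measurable_integrable _ (bounded_measurable_comp bf)).
by apply: (eq_measure_integral m) => A mA _; exact: mps.
Qed.

(** [max_sum f n w] is the maximum of the Birkhoff sums
    [\sum_(i < k) f (s^i w)], [0 <= k <= n]; the recursion is the identity on
    which the maximal inequality rests. *)
Fixpoint max_sum f n w : R :=
  if n is k.+1 then Num.max 0 (f w + max_sum f k (s w)) else 0.

Lemma max_sum_ge0 f n w : 0 <= max_sum f n w.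
Proof. by case: n => //= n; rewrite le_max lexx. Qed.

Lemma max_sumS f n w : max_sum f n w <= max_sum f n.+1 w.
Proof.
elim: n w => [|n IH] w; first exact: max_sum_ge0.
by rewrite [leRHS]/= [leLHS]/= ge_max !le_max lexx/= lerD2l IH orbT.
Qed.

Lemma max_sum_nd f w : {homo max_sum f ^~ w : n k / (n <= k)%N >-> n <= k}.
Proof. by apply: homo_leq => // [x y z|n]; [exact: le_trans|exact: max_sumS]. Qed.

Lemma birkhoff_le_max_sum f n w :
  \sum_(i < n) f (iter i s w) <= max_sum f n w.
Proof.
elim: n w => [|n IH] w; first by rewrite big_ord0.
rewrite big_ord_recl/= le_max; apply/orP; right; rewrite lerD2l.
rewrite (eq_bigr (fun i : 'I_n => f (iter i s (s w)))) => [|i _]; first exact: IH.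
by rewrite -iterSr.
Qed.

Lemma bounded_measurable_max_sum f n : bounded_measurable f ->
  bounded_measurable (max_sum f n).
Proof.
move=> bf; elim: n => [|n IH] /=.
  by split; [exact: measurable_cst|exists 0 => w; rewrite normr0].
have [mg [K gK]] := bounded_measurableD bf (bounded_measurable_comp IH).
split; first by apply: measurable_maxr => //; exact: measurable_cst.
exists K => w; rewrite ger0_norm ?le_max ?lexx// ge_max.
by rewrite (le_trans (normr_ge0 _) (gK w)) (le_trans (ler_norm _) (gK w)).
Qed.

(** Garsia's argument: where [max_sum f n.+1] is positive it equals
    [f + max_sum f n \o s], so there [f] integrates to at least
    [int max_sum f n.+1 - int max_sum f n \o s >= 0]. *)
Lemma maximal_ergodic f n : bounded_measurable f ->
  0 <= \int[m]_(w in [set w | 0 < max_sum f n w]) f w.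
Proof.
move=> bf; case: n => [|n].
  rewrite (_ : [set _ | _] = set0) ?Rintegral_set0//.
  by rewrite -subset0 => w /=; rewrite ltxx.
set M := max_sum f; set A := [set w | _].
have bM k : bounded_measurable (M k) by exact: bounded_measurable_max_sum.
have bMs k : bounded_measurable (M k \o s) by exact: bounded_measurable_comp.
have mA : measurable A by apply: measurable_gt_fun; apply: (bM _).1.
have iT g : bounded_measurable g -> m.-integrable setT (EFin \o g).
  exact: bounded_measurable_integrable.
have iA g : bounded_measurable g -> m.-integrable A (EFin \o g).
  exact: bounded_measurable_integrable.
have -> : \int[m]_(w in A) f w = \int[m]_(w in A) (M n.+1 w - M n (s w)).
  apply: eq_Rintegral => w; rewrite inE /A /= lt_max ltxx/= => wA.
  by rewrite /M /= max_r ?addrK// ltW.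
rewrite RintegralB//; [|exact: iA|exact: (iA (M n \o s))].
have e1 : \int[m]_(w in A) M n.+1 w = \int[m]_w M n.+1 w.
  rewrite Rintegral_mkcond; apply: eq_Rintegral => w _; rewrite patchE.
  case: ifPn => //; rewrite notin_setE /A /= => /negP; rewrite -leNgt => h.
  by apply/eqP; rewrite eq_sym eq_le h max_sum_ge0.
have e2 : \int[m]_(w in A) M n (s w) <= \int[m]_w M n (s w).
  rewrite Rintegral_mkcond; apply: le_Rintegral => //.
  - by rewrite -restrict_EFin; apply/(integrable_mkcond _ mA)/(iA (M n \o s)).
  - exact: (iT (M n \o s)).
  - by move=> w _; rewrite patchE; case: ifP => // _; exact: max_sum_ge0.
rewrite subr_ge0 (le_trans e2)// e1 (Rintegral_measure_preserving (bM n)).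
by apply: le_Rintegral => //; [exact: iT|exact: iT|move=> w _; exact: max_sumS].
Qed.

Hypothesis s_erg : ergodic m s.

(** The set where the Birkhoff sums are unbounded above is invariant. If it had
    full measure, the sets of the maximal inequality would exhaust the space
    and [f] would have a nonnegative integral. *)
Lemma birkhoff_bounded_above f : bounded_measurable f -> \int[m]_w f w < 0 ->
  \forall w \ae m, exists K, forall n, \sum_(i < n) f (iter i s w) <= K.
Proof.
move=> bf f0; pose M := max_sum f.
have bM k : bounded_measurable (M k) by exact: bounded_measurable_max_sum.
(* By the recursion for [M], this set is invariant without exception. *)
pose A := \bigcap_k \bigcup_n [set w | k%:R < M n w].
have mA : measurable A.
  apply: bigcapT_measurable => k; apply: bigcupT_measurable => n.
  by apply: measurable_gt_fun; apply: (bM _).1.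
have AP w : A w <-> forall c, exists n, c < M n w.
  split=> [Aw c|Aw k _]; last by have [n ?] := Aw k%:R; exists n.
  have [n _ /= h] := Aw (Num.bound `|c|) I; exists n; apply: lt_trans h.
  by rewrite (le_lt_trans (ler_norm _))// archi_boundP.
have sA : s @^-1` A = A.
  apply/seteqP; split => w; rewrite /preimage /= !AP => Aw c.
    have [n cn] := Aw (c - f w); exists n.+1.
    by rewrite /M /= lt_max -ltrBlDl cn orbT.
  have [n cn] := Aw (Num.max 0 (c + f w)); exists n.
  have := lt_le_trans cn (max_sumS f n w).
  by rewrite /M /= lt_max => /orP[]; rewrite gt_max ?ltxx//= => /andP[_]; lra.
case: (s_erg mA sA) => mA01.
  exists A; split=> // w /= nK; apply/AP => c; apply: contra_notP nK => nc.
  exists c => n; rewrite (le_trans (birkhoff_le_max_sum _ _ _))// leNgt.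
  by apply/negP => ?; apply: nc; exists n.
exfalso; move: f0; rewrite ltNge => /negP; apply.
pose B n := [set w | 0 < M n w].
have mB n : measurable (B n) by apply: measurable_gt_fun; apply: (bM _).1.
have [mf [K fK]] := bf.
have cv : \int[m]_w (f \_ (B n)) w @[n --> \oo] --> \int[m]_w f w.
  apply: (@cvg_Rintegral_bounded _ _ K _ _ _ _).2 => //.
  - move=> n; apply/(measurable_restrictT _ _).1 => //.
    exact: measurable_funS mf.
  - by move=> n w; rewrite patchE; case: ifP => // _; rewrite normr0 (le_trans _ (fK w)).
  - exists (~` A); split; [exact: measurableC| |].
      by have := probability_setC m mA; rewrite mA01 subee.
    move=> w /= h Aw; apply: h.
    have [n n0] := (AP w).1 Aw 0; apply: cvg_near_cst.
    exists n => // k /= nk; rewrite patchE mem_set//.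
    by rewrite /B /= (lt_le_trans n0)// max_sum_nd.
rewrite -(cvg_lim _ cv)//; apply: limr_ge; first by apply/cvg_ex; eexists; exact: cv.
by apply: nearW => n; have := maximal_ergodic n bf; rewrite Rintegral_mkcond.
Qed.

Lemma birkhoff_lt f c : bounded_measurable f -> \int[m]_w f w < c ->
  \forall w \ae m, \forall N \near \oo, N%:R^-1 * \sum_(i < N) f (iter i s w) < c.
Proof.
move=> bf fc; pose b := (\int[m]_w f w + c) / 2.
have bcst r : bounded_measurable (fun=> r) by split => //; exists `|r|.
have bg : bounded_measurable (fun w => f w + - b) by exact: bounded_measurableD.
have iT g : bounded_measurable g -> m.-integrable setT (EFin \o g).
  exact: bounded_measurable_integrable.
have : \int[m]_w (f w + - b) < 0.
  rewrite RintegralD//; [|exact: iT|exact: iT (bcst _)].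
  have -> : \int[m]_w (- b) = - b.
    rewrite Rintegral_cst//; transitivity (- b * fine 1%E); last by rewrite mulr1.
    by congr (_ * fine _); exact: probability_setT.
  by rewrite /b; lra.
move=> /(birkhoff_bounded_above bg); apply: filterS => w [K hK].
have cb : 0 < c - b by rewrite /b; lra.
exists (Num.bound `|K / (c - b)|).+1 => // N /= hN.
have N0 : 0 < N%:R :> R by rewrite ltr0n; apply: leq_trans hN.
rewrite mulrC ltr_pdivrMr//.
have := hK N; rewrite big_split /= sumr_const card_ord mulNrn -[b *+ N]mulr_natr => h.
have : K < (c - b) * N%:R.
  rewrite mulrC -ltr_pdivrMr//; apply: le_lt_trans (ler_norm _) _.
  by rewrite (lt_le_trans (archi_boundP _))// ler_nat ltnW.
by move: h; rewrite mulrBl; move: (b * _) (c * _) => x y; lra.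
Qed.

(** The averages of [u_N] along the orbit are dominated by those of the tail
    suprema [sup_(k >= M) u_k], to which the ergodic theorem applies; the
    integrals of these suprema tend to that of the limit. *)
Lemma birkhoff_seq_lt (u : nat -> Omega -> R) (psi : Omega -> R) K c :
  (forall N, measurable_fun setT (u N)) -> (forall N w, `|u N w| <= K) ->
  measurable_fun setT psi -> (\forall w \ae m, u ^~ w @ \oo --> psi w) ->
  \int[m]_w psi w < c ->
  \forall w \ae m, \forall N \near \oo,
    N%:R^-1 * \sum_(i < N) u N (iter i s w) < c.
Proof.
move=> mu uK mpsi upsi psic.
have ubd w : has_ubound (range (u ^~ w)).
  by exists K => _ [n _ <-]; rewrite (le_trans (ler_norm _)).
pose U M w := sups (u ^~ w) M.
have uU w M N : (M <= N)%N -> u N w <= U M w.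
  by move=> MN; apply: ub_le_sup; [exact: has_ubound_sdrop|exists N].
have UK M w : `|U M w| <= K.
  rewrite ler_norml; apply/andP; split.
    apply: le_trans (uU w M M (leqnn _)).
    by rewrite lerNl (le_trans (ler_norm _))// normrN.
  apply: ge_sup; first by exists (u M w); exists M => /=.
  by move=> _ [n _ <-]; rewrite (le_trans (ler_norm _)).
have mU M : measurable_fun setT (U M) by apply: measurable_fun_sups.
have bU M : bounded_measurable (U M) by split => //; exists K.
have cv : \int[m]_w U n w @[n --> \oo] --> \int[m]_w psi w.
  apply: (cvg_Rintegral_bounded mU UK mpsi _).2.
  by apply: filterS upsi => w uw; exact: cvg_sups uw.
have [M _ UMc] := cvgr_lt _ cv _ psic.
have := birkhoff_lt (bU M) (UMc M (leqnn M)); apply: filterS => w.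
apply: filterS2 (nbhs_infty_ge M).
move=> N MN; apply: le_lt_trans; rewrite ler_wpM2l ?invr_ge0//.
by apply: ler_sum => i _; exact: uU.
Qed.

Lemma birkhoff_seq (u : nat -> Omega -> R) (psi : Omega -> R) K :
  (forall N, measurable_fun setT (u N)) -> (forall N w, `|u N w| <= K) ->
  measurable_fun setT psi -> (\forall w \ae m, u ^~ w @ \oo --> psi w) ->
  \forall w \ae m,
    N%:R^-1 * \sum_(i < N) u N (iter i s w) @[N --> \oo] --> \int[m]_w psi w.
Proof.
move=> mu uK mpsi upsi.
(* The lower bound is the upper bound for [- u]. *)
have H1 : \forall w \ae m, forall k, \forall N \near \oo,
    N%:R^-1 * \sum_(i < N) u N (iter i s w) < \int[m]_w psi w + k.+1%:R^-1.
  apply/ae_foralln => k; apply: (birkhoff_seq_lt mu uK mpsi upsi).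
  by rewrite ltrDl.
have H2 : \forall w \ae m, forall k, \forall N \near \oo,
    N%:R^-1 * \sum_(i < N) - u N (iter i s w) < \int[m]_w (- psi w) + k.+1%:R^-1.
  apply/ae_foralln => k.
  apply: (@birkhoff_seq_lt (fun N w => - u N w) (fun w => - psi w) K).
  - by move=> N; exact: measurable_funN.
  - by move=> N w; rewrite normrN.
  - exact: measurable_funN.
  - by apply: filterS upsi => w uw; exact: (cvgN uw).
  - by rewrite ltrDl.
apply: filterS2 H1 H2 => w H1 H2.
apply/cvgrPdist_lt => /= e e0.
have [k ke] : exists k, k.+1%:R^-1 < e.
  exists (Num.bound e^-1); rewrite invf_plt ?posrE//.
  by rewrite (lt_trans (archi_boundP _)) ?invr_ge0 ?ltW// ltr_nat.
apply: filterS2 (H1 k) (H2 k) => N.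
rewrite (sumrN _ _ (fun i : 'I_N => u N (iter i s w))) mulrN.
have -> : \int[m]_w (- psi w) = - \int[m]_w psi w.
  have [ip _] := cvg_Rintegral_bounded mu uK mpsi upsi.
  by rewrite -[RHS]mulN1r -RintegralZl//; under eq_Rintegral do rewrite -mulN1r.
move: (\int[m]_w psi w) (N%:R^-1 * _) (k.+1%:R^-1) ke => b a r re h1 h2.
by rewrite ltr_distl; apply/andP; split; lra.
Qed.

(** Truncation at the level [K] reduces this to bounded functions, and the upper
    limit of the truncated functions is a measurable version of [psi]. *)
Lemma birkhoff_seq_ae (u : nat -> Omega -> R) (psi : Omega -> R) K :
  (forall N, measurable_fun setT (u N)) ->
  (\forall w \ae m, forall N, (0 < N)%N -> `|u N w| <= K) ->
  (\forall w \ae m, u ^~ w @ \oo --> psi w) ->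
  \forall w \ae m,
    N%:R^-1 * \sum_(i < N) u N (iter i s w) @[N --> \oo] --> \int[m]_w psi w.
Proof.
move=> mu uK upsi.
pose v N w := Num.max (- `|K|) (Num.min `|K| (u N w)).
have vK N w : `|v N w| <= `|K|.
  rewrite ler_norml /v le_max lexx/= ge_max ge_min lexx/= andbT.
  by rewrite (le_trans _ (normr_ge0 K))// oppr_le0.
have mv N : measurable_fun setT (v N).
  apply: measurable_maxr; first exact: measurable_cst.
  by apply: measurable_minr => //; exact: measurable_cst.
have uv w N : `|u N w| <= K -> v N w = u N w.
  move=> uK'; have := le_trans uK' (ler_norm K).
  by rewrite ler_norml => /andP[? ?]; rewrite /v min_r// max_r.
pose psi' w := limn_sup (v ^~ w).
have mpsi' : measurable_fun setT psi'.
  apply: measurable_fun_limn_sup => // w _.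
    by exists `|K| => _ [n _ <-]; rewrite (le_trans (ler_norm _)).
  exists (- `|K|) => _ [n _ <-].
  by have := vK n w; rewrite ler_norml => /andP[].
have vpsi : \forall w \ae m, v ^~ w @ \oo --> psi w.
  apply: filterS2 uK upsi => w uKw; apply: cvg_trans; apply: near_eq_cvg.
  by exists 1 => // N /= N1; rewrite uv// uKw.
have psiE : \forall w \ae m, psi' w = psi w.
  by apply: filterS vpsi => w vw; apply: cvg_lim => //; exact: cvg_sups vw.
have vpsi' : \forall w \ae m, v ^~ w @ \oo --> psi' w.
  by apply: filterS2 vpsi psiE => w ? ->.
have := birkhoff_seq mv vK mpsi' vpsi'; apply: filterS2 (ae_iter uK) => w uKw.
rewrite (ae_eq_Rintegral mpsi' psiE); apply: cvg_trans; apply: near_eq_cvg.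
exists 1 => // N /= N1; congr (_ * _); apply: eq_bigr => i _.
by rewrite uv// uKw.
Qed.

End ergodic_theorem.

(** * Limits of real sequences *)

Section real_limits.
Context (R : realType).
Implicit Types (r s b : nat -> R) (K c : R).

(** The existence of both limits is part of the conclusion: [r] is Cauchy, being
    eventually within [b n + e] of the constant [s n]. *)
Lemma cvg_double_limit r s b : b @ \oo --> (0 : R) ->
  (forall n (e : R), 0 < e -> \forall N \near \oo, `|r N - s n| <= b n + e) ->
  exists2 l : R, r @ \oo --> l & s @ \oo --> l.
Proof.
move=> b0 rs.
have cr : cvgn r.
  apply/cauchy_cvgP/cauchy_exP => e e0.
  have e4 : 0 < e / 8 by rewrite divr_gt0.
  have [n _ bn] := cvgr0_norm_lt _ b0 _ e4.
  have [N _ rN] := rs n _ e4.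
  exists (r N); exists N => // M /= NM; rewrite /ball /=.
  have h1 := rN M NM; have h2 := rN N (leqnn N).
  have h3 := bn n (leqnn n).
  have h4 := ler_distD (s n) (r N) (r M); have h5 := ler_norm (b n).
  rewrite (distrC (s n)) in h4; apply: le_lt_trans h4 _; move: h1 h2 h3 h5 e0.
  move: `|b n| `|r N - _| `|r M - _| (b n) => x y z t; lra.
exists (limn r) => //; apply/cvgrPdist_le => /= e e0.
have e2 : 0 < e / 2 by rewrite divr_gt0.
apply: filterS (cvgr0_norm_lt _ b0 _ e2) => n bn.
have := rs n _ e2 => rn.
have h : (fun N => `|r N - s n|) @ \oo --> `|limn r - s n|.
  by apply: cvg_norm; apply: cvgB => //; exact: cvg_cst.
rewrite -(cvg_lim _ h)//; apply: limr_le.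
  by apply/cvg_ex; eexists; exact: h.
apply: filterS rn => N; have := ler_norm (b n); move: bn.
by move: `|b n| `|r N - _| (b n) => x y z; lra.
Qed.

Lemma cvg_invn c : (fun N => c / N%:R) @ \oo --> (0 : R).
Proof.
rewrite -[X in _ --> X](mulr0 c); apply: cvgM; first exact: cvg_cst.
by apply/gtr0_cvgV0; [exists 1%N => // n /= n0; rewrite ltr0n|exact: cvgr_idn].
Qed.

(** [1 - y] is the inverse of [1 + y / (1 - y)], which is at most the
    exponential of [y / (1 - y) <= y + 2 y^2]. *)
Lemma expR_le_1B (y : R) : `|y| <= 1/2 -> expR (- y - 2 * y ^+ 2) <= 1 - y.
Proof.
rewrite ler_norml => /andP[y1 y2].
have y0 : 0 < 1 - y by lra.
rewrite -[leRHS]invrK -[leLHS]invrK lef_pV2 ?posrE ?invr_gt0 ?expR_gt0//.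
rewrite -expRN; apply: le_trans (_ : expR (y / (1 - y)) <= _); last first.
  rewrite ler_expR ler_pdivrMr// -subr_ge0.
  have -> : - (- y - 2 * y ^+ 2) * (1 - y) - y = y ^+ 2 * (1 - 2 * y) by ring.
  by rewrite mulr_ge0 ?sqr_ge0//; lra.
apply: le_trans (expR_ge1Dx _).
rewrite [leLHS](_ : _ = 1 + y / (1 - y))//.
by field; rewrite gt_eqF.
Qed.

(** A squeeze between [exp (- y)] and [exp (- y - 2 y^2)] in each factor
    [1 - y]; with [y = x N j / N] the quadratic terms add up to [O(1/N)]. *)
Lemma cvg_prod_expR (x : nat -> nat -> R) K c :
  (forall N j, (j < N)%N -> `|x N j| <= K) ->
  N%:R^-1 * \sum_(j < N) x N j @[N --> \oo] --> c ->
  \prod_(j < N) (1 - x N j / N%:R) @[N --> \oo] --> expR (- c).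
Proof.
move=> xK xc.
have K0 : 0 <= `|K| by [].
have lo : expR (- (N%:R^-1 * \sum_(j < N) x N j) - 2 * K ^+ 2 * N%:R^-1)
    @[N --> \oo] --> expR (- c).
  apply: continuous_cvg; first exact: continuous_expR.
  rewrite -[X in _ --> X]subr0; apply: cvgB; first exact: cvgN.
  exact: cvg_invn.
have hi : expR (- (N%:R^-1 * \sum_(j < N) x N j)) @[N --> \oo] --> expR (- c).
  by apply: continuous_cvg; [exact: continuous_expR|exact: cvgN].
apply: squeeze_cvgr lo hi.
(* From this index on every factor is [1 - y] with [`|y| <= 1/2]. *)
exists (Num.bound (2 * `|K|)).+1 => // N /= hN.
have N0 : 0 < N%:R :> R by rewrite ltr0n; apply: leq_trans hN.
have NK : 2 * `|K| <= N%:R.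
  apply/ltW/(lt_le_trans (archi_boundP _)); first by rewrite mulr_ge0.
  by rewrite ler_nat ltnW.
have xN (j : 'I_N) : `|x N j / N%:R| <= 1 / 2.
  rewrite normrM normfV (gtr0_norm N0) ler_pdivrMr//.
  have := xK N j (ltn_ord j); have := ler_norm K; move: NK.
  by move: `|K| `|x N j| N%:R => a b e; lra.
apply/andP; split.
  apply: le_trans (_ : \prod_(j < N)
     expR (- (x N j / N%:R) - 2 * (x N j / N%:R) ^+ 2) <= _).
    rewrite -expR_sum ler_expR big_split /= !sumrN -mulr_suml.
    rewrite [(\sum_(i < N) _) / _]mulrC.
    rewrite lerD2l lerN2 -mulr_sumr -mulrA ler_pM2l//.
    apply: le_trans (_ : \sum_(j < N) (K / N%:R) ^+ 2 <= _); last first.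
      rewrite sumr_const card_ord -[_ *+ N]mulr_natr.
      rewrite exprMn -mulrA ler_wpM2l ?sqr_ge0// expr2 -mulrA mulVf ?mulr1//.
      by rewrite gt_eqF.
    apply: ler_sum => j _; rewrite !exprMn ler_wpM2r ?sqr_ge0//.
    rewrite -[leLHS]real_normK ?num_real// ler_sqr ?nnegrE//; first exact: xK.
    by apply: le_trans (xK N j (ltn_ord j)).
  apply: ler_prod => j _; rewrite expR_ge0/=; exact: expR_le_1B.
rewrite -mulrN -sumrN mulr_sumr expR_sum; apply: ler_prod => j _.
apply/andP; split; last by rewrite mulrN [_^-1 * _]mulrC; exact: expR_ge1Dx.
by have := ler_norm (x N j / N%:R); have := xN j; lra.
Qed.

End real_limits.

(** * Integration and conformality on the fibres *)

Section fibres.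
Context (R : realType) (d : measure_display) (Omega : measurableType d).
Context (m : probability Omega R) (X : completeMetricType R).
Context (S : open_system Omega X).
Hypothesis hclosed : closed_system m S.
Hypothesis hopen : open_holes m S.

Local Notation s := (sigma S).
Local Notation J := (J S).
Local Notation nu0 := (nu S 0).
Local Notation phi := (phi S).
Local Notation hole := (hole S).
Local Notation lambda := (lambda S).
Local Notation one := (Defs.one S).
Implicit Types (w : Omega) (A C : set (borel X)).

(** All quantities are expressed through these real-valued integrals. The
    intersection with the fibre lets [A] be any Borel set of [X], so that sets
    in different fibres can be transported without dependent types. *)
Definition fint w (f : B S w) A : R :=
  \int[nu0 w]_(x in A `&` J w) ev S f x.

Definition fmass w A : R := fine (nu0 w (A `&` J w)).

Lemma measurable_fibre w : measurable (J w : set (borel X)).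
Proof.
rewrite -[X in measurable X]setCK; apply: measurableC.
by apply: sub_sigma_algebra; exact/closed_openC/(cs_J hclosed).1.
Qed.

Lemma measurable_fibreI w A : measurable A -> measurable (A `&` J w : set (borel X)).
Proof. by move=> mA; apply: measurableI => //; exact: measurable_fibre. Qed.

Lemma nu0_setT w : nu0 w setT = 1%E.
Proof.
have [J1 J0] := cs_nu_prob hclosed w; have mJ := measurable_fibre w.
by rewrite -(setUv (J w)) measureU ?setICr//= ?J1 ?J0 ?adde0//; exact: measurableC.
Qed.

Lemma nu0_fin w A : measurable A -> (nu0 w A < +oo)%E.
Proof.
move=> mA; apply: (@le_lt_trans _ _ 1%E); last by rewrite ltry.
by rewrite -(nu0_setT w); apply: le_measure; rewrite ?inE.
Qed.

Lemma ev_integrable w (f : B S w) A : measurable A ->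
  (nu0 w).-integrable (A `&` J w) (EFin \o ev S f).
Proof.
move=> mA; have mJ := measurable_fibre w.
suff : (nu0 w).-integrable (J w) (EFin \o ev S f).
  by apply: integrableS => //; exact: measurable_fibreI.
apply/(integrable_mkcond _ mJ); rewrite restrict_EFin; apply/Lfun1_integrable.
apply: (@Lfun_subset _ _ _ (nu0 w) _ +oo%E) (cs_ev_Linfty hclosed f) => //.
- by rewrite leey.
- by rewrite ge0_fin_numE// nu0_fin.
- by rewrite leey.
Qed.

Lemma fint_lin w (a : R) (f g : B S w) A : measurable A ->
  fint (a *: f + g) A = a * fint f A + fint g A.
Proof.
move=> mA; have mAJ := measurable_fibreI w mA; rewrite /fint.
have i1 := ev_integrable f mA; have i2 := ev_integrable g mA.
rewrite -RintegralZl// -RintegralD//.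
  by apply: eq_Rintegral => x; rewrite inE => -[_ Jx]; rewrite (cs_ev_lin hclosed).
by rewrite (_ : _ \o _ = (fun x => a%:E * (EFin \o ev S f) x)%E)//; exact: integrableZl.
Qed.

Lemma fintZ w (a : R) (f : B S w) A : measurable A ->
  fint (a *: f) A = a * fint f A.
Proof.
move=> mA; have h0 : fint (0 : B S w) A = 0.
  by have := fint_lin (-1) (0 : B S w) 0 mA; rewrite scaler0 add0r; lra.
by rewrite -[a *: f]addr0 fint_lin// h0 addr0.
Qed.

Lemma fint_setD w (f : B S w) A C : measurable A -> measurable C ->
  fint f (A `\` C) = fint f A - fint f (A `&` C).
Proof.
move=> mA mC; apply/eqP; rewrite eq_sym subr_eq eq_sym; apply/eqP.
rewrite /fint -Rintegral_setU.
- congr (Rintegral _ _ _); rewrite -setIUl; congr (_ `&` _).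
  by rewrite setUC setUIDK.
- by apply: measurable_fibreI; exact: measurableD.
- by apply: measurable_fibreI; exact: measurableI.
- rewrite -setIUl; apply: ev_integrable.
  by apply: measurableU; [exact: measurableD|exact: measurableI].
- by apply/disj_setPS => x [[[_ nC] _] [[_ ?] _]].
Qed.

Lemma fint_fibre w (f : B S w) A : J w `<=` A -> fint f A = nu_int 0 f.
Proof. by move=> JA; rewrite /fint setIC setIidl. Qed.

Lemma mu_fint w A : measurable A -> mu S w A = (fint (phi 0 w) A)%:E.
Proof.
move=> mA; rewrite /mu /fint /Rintegral fineK//; apply: integrable_fin_num.
  exact: measurable_fibreI.
exact: ev_integrable.
Qed.

Lemma fint_bound w (f : B S w) A (K : R) : measurable A -> 0 <= K ->
  (sup_norm f <= K%:E)%E -> `|fint f A| <= K * fmass w A.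
Proof.
move=> mA K0; rewrite /sup_norm unlock /Lnorm nu0_setT lte01 => /ess_supP fK.
have mAJ := measurable_fibreI w mA; have := ev_integrable f mA.
move=> /[dup] intf /integrableP[mf _].
rewrite -lee_fin (le_trans (_ : _ <= \int[nu0 w]_(x in A `&` J w) `|(ev S f x)%:E|)%E)//.
  rewrite EFin_normr_Rintegral//; exact: le_abse_integral.
rewrite /fmass EFinM fineK; last by rewrite ge0_fin_numE// nu0_fin.
rewrite -integral_cst//; apply: ae_ge0_le_integral => //.
- exact: measurableT_comp.
- by apply: filterS fK => x ? _.
Qed.

(** Errors are naturally bounded by [nu_0]-masses, while the scaling of the holes
    and the invariance under [T] concern [mu]. *)
Lemma fmass_le w A (K : R) : measurable A -> 0 < K ->
  (forall x, J w x -> K^-1 <= ev S (phi 0 w) x) ->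
  fmass w A <= K * fint (phi 0 w) A.
Proof.
move=> mA K0 hK; have mAJ := measurable_fibreI w mA.
rewrite -ler_pdivrMl// -[X in _ * X]/(fine (nu0 w (A `&` J w))) -Rintegral_cst//.
apply: le_Rintegral => //; last by move=> x [_ /hK].
- apply: measurable_bounded_integrable => //; first exact: nu0_fin.
  exists `|K^-1|; split; rewrite ?num_real// => M KM x _; exact: ltW.
- exact: ev_integrable.
Qed.

Lemma measurable_hole N w : measurable (hole N w : set (borel X)).
Proof.
case: N => [|N]; first exact: measurable0.
have [A mA hA] := oh_meas hopen (ltn0Sn N).
rewrite (_ : Defs.hole _ _ _ = xsection A w `&` J w).
  by apply: measurable_fibreI; exact: measurable_xsection.
apply/seteqP; split => x.
  move=> hx; have : [set p | hole N.+1 p.1 p.2] (w, x) by [].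
  by rewrite hA => -[Jx Ax]; split => //; rewrite /xsection /= inE.
rewrite /xsection /= inE => -[Ax Jx].
by have : (total_space S `&` A) (w, x) by []; rewrite -hA.
Qed.

Definition pullback1 N w A : set (borel X) :=
  [set x | [/\ J w x, A (T S w x) & ~ hole N w x]].

(** The points whose first [n] iterates avoid the holes and whose [n]-th iterate
    is in [A], up to points outside the fibre; see [pullbackP]. The recursion
    removes the last step, as [op_iter] does. *)
Fixpoint pullback N n w A : set (borel X) :=
  if n is k.+1 then pullback N k w (pullback1 N (iter k s w) A) else A.

Lemma measurable_preimage w A : measurable A ->
  measurable ([set x | J w x /\ A (T S w x)] : set (borel X)).
Proof.
move=> mA; have mY : measurable (setT `*` A : set (Omega * borel X)).
  by apply: measurableX.
have [C mC hC] := cs_T_meas hclosed mY.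
rewrite (_ : [set _ | _] = xsection C w `&` J w).
  by apply: measurable_fibreI; exact: measurable_xsection.
apply/seteqP; split => x.
  move=> [Jx Ax].
  have : (total_space S `&`
      (fun p => (s p.1, T S p.1 p.2)) @^-1` (setT `*` A)) (w, x) by [].
  by rewrite hC => -[_ ?]; split => //; rewrite /xsection /= inE.
rewrite /xsection /= inE => -[Cx Jx].
by have : (total_space S `&` C) (w, x) by []; rewrite -hC => -[_ [_ ?]].
Qed.

Lemma pullback1E N w A :
  pullback1 N w A = [set x | J w x /\ A (T S w x)] `\` hole N w.
Proof. by apply/seteqP; split => x [] // []. Qed.

Lemma measurable_pullback1 N w A : measurable A -> measurable (pullback1 N w A).
Proof.
move=> mA; rewrite pullback1E; apply: measurableD; first exact: measurable_preimage.
exact: measurable_hole.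
Qed.

Lemma measurable_pullback N n w A : measurable A -> measurable (pullback N n w A).
Proof. by elim: n A => //= n IH A mA; apply: IH; exact: measurable_pullback1. Qed.

Lemma pullbackSr N n w A :
  pullback N n.+1 w A = pullback1 N w (pullback N n (s w) A).
Proof. by elim: n A => // n IH A; rewrite [LHS]IH /= -iterS iterSr. Qed.

Lemma pullback_sub N n w A C : A `<=` C -> pullback N n w A `<=` pullback N n w C.
Proof.
elim: n A C => //= n IH A C sAC; apply: IH => x [Jx Ax hx]; split => //; exact: sAC.
Qed.

Lemma fibre_iter n w x : J w x -> J (iter n s w) (T_iter S n w x).
Proof. by move=> Jx; elim: n => //= n IH; exact: (cs_T_J hclosed). Qed.

Lemma T_iterSr n w x : T_iter S n.+1 w x = T_iter S n (s w) (T S w x).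
Proof. by elim: n => // n IH; rewrite [LHS]/= -/(T_iter S n.+1 w x) IH -iterS iterSr. Qed.

Lemma pullbackP N n w A x : J w x -> pullback N n w A x <->
  A (T_iter S n w x) /\
  forall j, (j < n)%N -> ~ hole N (iter j s w) (T_iter S j w x).
Proof.
move=> Jx; elim: n A => [A|n IH A]; first by split=> // -[].
rewrite [pullback _ _ _ _]/= IH; split.
  move=> [[_ Ax hx] hj]; split => // j.
  by rewrite ltnS leq_eqVlt => /predU1P[->//|]; exact: hj.
move=> [Ax hj]; split => [|j jn]; last by apply: hj; exact: ltnW.
by split => //; [exact: fibre_iter|exact: hj].
Qed.

Lemma eq_transfer w (f g : X -> R) x :
  (forall y, J w y -> T S w y = x -> f y = g y) ->
  transfer S w f x = transfer S w g x.
Proof.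
move=> fg; rewrite /transfer /set_sum; congr (fine _ - fine _);
  apply: eq_esum => y [Jy Ty]; by rewrite ?funeposE ?funenegE /= fg.
Qed.

Lemma transfer0 w x : transfer S w (fun=> 0) x = 0.
Proof.
rewrite /transfer /set_sum !esum1 ?subrr// => y _.
  by rewrite funenegE /= mul0r oppr0 maxxx.
by rewrite funeposE /= mul0r maxxx.
Qed.

(** Duality of the transfer operator and the preimage of sets: on the fibre of
    [x] the indicator of [A] at [T y = x] is constant, so it can be moved inside
    the sum that defines the operator, to which conformality applies. *)
Lemma transfer_pullback1 N w (f : B S w) A : measurable A ->
  fint (L S N w f) A = lambda 0 w * fint f (pullback1 N w A).
Proof.
move=> mA; rewrite /fint.
have := cs_conformal hclosed f (measurable_pullback1 N w mA) => <-.
rewrite [RHS]Rintegral_mkcond [LHS]Rintegral_mkcond.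
apply: eq_Rintegral => x _; rewrite !patchE in_setI.
have [|] := boolP (x \in J (s w)); last by rewrite andbF.
rewrite inE andbT => Jx.
have -> : ev S (L S N w f) x =
    transfer S w (fun y => \1_(J w `\` hole N w) y * ev S f y) x.
  case: (posnP N) => [->|N0]; last exact: (oh_L hopen).
  rewrite (cs_L hclosed)//=; apply: eq_transfer => y Jy _.
  by rewrite setD0 indicE mem_set// mul1r.
have [xA|xA] := boolP (x \in A).
  apply: eq_transfer => y Jy Ty; congr (_ * _); rewrite !indicE; congr (_%:R).
  congr (nat_of_bool _); apply/idP/idP; rewrite !inE => -[? h] //.
    by split => //; rewrite Ty; apply/set_mem.
transitivity (transfer S w (fun=> 0) x); first by rewrite transfer0.
apply: eq_transfer => y Jy Ty.
rewrite indicE memNset ?mul0r// => -[_]; rewrite Ty => Ax _.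
by move: xA; rewrite mem_set.
Qed.

Lemma eq_fint w (f : B S w) A C :
  (forall x, J w x -> A x <-> C x) -> fint f A = fint f C.
Proof.
move=> AC; rewrite /fint; congr (Rintegral _ _ _).
by apply/seteqP; split => x [? Jx]; split => //; apply/(AC x Jx).
Qed.

Lemma fint_phi_ge0 w A : 0 <= fint (phi 0 w) A.
Proof. by apply: Rintegral_ge0 => x [_ /(cs_phi_gt0 hclosed)/ltW]. Qed.

Lemma le_fint_phi w A C : measurable A -> measurable C ->
  A `<=` C -> fint (phi 0 w) A <= fint (phi 0 w) C.
Proof.
move=> mA mC sAC; have := fint_setD (phi 0 w) mC mA.
by rewrite (setIidr sAC) -subr_ge0 => <-; exact: fint_phi_ge0.
Qed.

(** Invariance of [mu] under the fibre maps; with the index [0] of the closed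
    system nothing is removed from the preimage. *)
Lemma fint_phi_invariant w A : measurable A ->
  fint (phi 0 w) (pullback1 0 w A) = fint (phi 0 (s w)) A.
Proof.
move=> mA; apply: (mulfI (cs_lambda_neq0 hclosed w)).
by rewrite -transfer_pullback1// (cs_phi hclosed) fintZ.
Qed.

Lemma fint_phi_invariant_iter n w A : measurable A ->
  fint (phi 0 w) (pullback 0 n w A) = fint (phi 0 (iter n s w)) A.
Proof.
elim: n A => //= n IH A mA; rewrite IH ?fint_phi_invariant//.
exact: measurable_pullback1.
Qed.

(** * Return probabilities and the numbers qhat *)

Definition hole_mu N w : R := fint (phi 0 w) (hole N w).

Lemma sigmaVK_iter n w : iter n s (iter n (sigmaV S) w) = w.
Proof.
elim: n w => // n IH w; rewrite iterS (iterSr n (sigmaV S)) IH.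
exact: cs_sigmaVK hclosed w.
Qed.

Lemma iter_sigma_sigmaV i n w : (i <= n)%N ->
  iter i s (iter n (sigmaV S) w) = iter (n - i) (sigmaV S) w.
Proof. by move=> leq_in; rewrite -{1}(subnKC leq_in) iterD sigmaVK_iter. Qed.

(** The denominator of [qhat]: by invariance it does not depend on [k]. *)
Lemma mu_return k N w (w' := iter k.+1 (sigmaV S) w) :
  mu S w' [set x | J w' x /\ hole N w (T_iter S k.+1 w' x)] =
  (hole_mu N w)%:E.
Proof.
have mH := measurable_hole N w; have mP := measurable_pullback 0 k.+1 w' mH.
have -> : mu S w' [set x | J w' x /\ hole N w (T_iter S k.+1 w' x)] =
    mu S w' (pullback 0 k.+1 w' (hole N w)).
  rewrite /mu; congr (integral _ _ _); apply/seteqP; split => x.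
    by move=> [[_ hx] Jx]; split => //; apply/(pullbackP _ _ _ Jx); split => // j _ [].
  by move=> [/(pullbackP _ _ _ _)+ Jx] => /(_ Jx)[hx _]; split.
by rewrite mu_fint// fint_phi_invariant_iter// sigmaVK_iter.
Qed.

Lemma qhat_numerator k N w (w' := iter k.+1 (sigmaV S) w) :
  hole_mu N w != 0 ->
  fint (phi 0 w') (pullback1 0 w' (pullback N k (s w') (hole N w)) `&` hole N w') =
  qhat S k N w * hole_mu N w.
Proof.
move=> hN0; rewrite /qhat -/w' mu_return /= -mulrA mulVf// mulr1.
have mH := measurable_hole N w; have mP := measurable_pullback N k (s w') mH.
rewrite -[LHS]/(fine (_%:E)) -mu_fint; last first.
  by apply: measurableI; [exact: measurable_pullback1|exact: measurable_hole].
congr (fine (mu _ _ _)); apply/seteqP; split => x.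
  move=> [[Jx Px _] hx]; have JTx := cs_T_J hclosed Jx.
  move/(pullbackP N k (hole N w) JTx) : Px; rewrite -T_iterSr => -[Hx nHx].
  split => // j /andP[j1 jk]; have := nHx (k - j)%N.
  rewrite ltn_subrL j1 (leq_trans j1 jk) => /(_ isT).
  rewrite -T_iterSr -subSn// -iterSr -subSn//.
  by rewrite iter_sigma_sigmaV ?leq_subr// subKn// (leq_trans jk).
move=> [Jx Hx nHx hx]; have JTx := cs_T_J hclosed Jx.
split => //; split => //; apply/(pullbackP N k (hole N w) JTx).
rewrite -T_iterSr; split => // i ik.
have := nHx (k - i)%N; rewrite subn_gt0 ik leq_subr => /(_ isT).
rewrite subSn ?leq_subr// subKn 1?ltnW// -T_iterSr -iterSr.
suff -> : iter i.+1 s w' = iter (k - i) (sigmaV S) w by [].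
by apply: (@iter_sigma_sigmaV i.+1 k.+1); exact: ltnW.
Qed.

(** Removing the hole in the initial fibre from the preimage of the set for [n]
    steps costs exactly the numerator of the [n]-th [qhat]. *)
Lemma survivor_phi n N w (w' := iter n (sigmaV S) w) : hole_mu N w != 0 ->
  fint (phi 0 w') (pullback N n w' (hole N w)) =
  hole_mu N w * (1 - \sum_(k < n) qhat S k N w).
Proof.
move=> hN0; rewrite /w' {w'}; elim: n => [|n IH]; first by rewrite big_ord0 subr0 mulr1.
rewrite pullbackSr big_ord_recr opprD addrA mulrDr -IH iterS.
set w' := sigmaV S _.
have mP : measurable (pullback N n (s w') (hole N w)).
  by apply: measurable_pullback; exact: measurable_hole.
have -> : pullback1 N w' (pullback N n (s w') (hole N w)) =
    pullback1 0 w' (pullback N n (s w') (hole N w)) `\` hole N w'.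
  apply/seteqP; split => [x [Jx Ax hx]|x [[Jx Ax _] hx]]; last by split.
  by split => //; split.
rewrite fint_setD//; [|exact: measurable_pullback1|exact: measurable_hole].
rewrite fint_phi_invariant// /w' -iterS qhat_numerator// iterS.
by rewrite (cs_sigmaVK hclosed) [hole_mu _ _ * _]mulrC mulNr.
Qed.

(** * Perturbation of the leading eigenvalue *)

Section regular.
Context (Q : nat -> forall w, B S w -> B S (s w)) (K : R).

(** The properties that the assumptions provide in almost every fibre, with a
    common constant [K]; they are used along whole orbits. *)
Record regular_fibre w : Prop := {
  rf_phi : forall N, L S N w (phi N w) = lambda N w *: phi N (s w) ;
  rf_normal : forall N, nu_int 0 (phi N w) = 1 ;
  rf_one : nu_int 0 (one w) = 1 ;
  rf_split : forall N (f : B S w),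
    (lambda N w)^-1 *: L S N w f = nu_int N f *: phi N (s w) + Q N f ;
  rf_Q : forall N (f : B S w), nu_int N (Q N f) = 0 ;
  rf_sup : forall N, (sup_norm (phi N w) <= K%:E)%E ;
  rf_norm : `|phi 0 w| <= K ;
  rf_low : forall x, J w x -> K^-1 <= ev S (phi 0 w) x ;
  rf_hole : forall N, (0 < N)%N -> hole_mu N w <= K / N%:R }.

Definition regular_orbit w := forall k, regular_fibre (iter k s w).

Hypothesis K1 : 1 <= K.
Hypothesis lambda_gt0 : forall N w, 0 < lambda N w.

Let K0 : 0 < K. Proof. exact: lt_le_trans ltr01 K1. Qed.

Lemma regular_orbit_iter n w : regular_orbit w -> regular_orbit (iter n s w).
Proof. by move=> h k; rewrite -iterD; exact: h. Qed.

(** The proportion of mass lost through the hole in one step. *)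
Definition escape N w : R := 1 - lambda N w / lambda 0 w.

(** Integrate [L_N phi_N = lambda_N phi_N] against [nu_0]: both eigenfunctions
    have integral [1], and conformality turns the left-hand side into [lambda_0]
    times the integral of [phi_N] off the hole. *)
Lemma escapeE N w : regular_orbit w ->
  escape N w = fint (phi N w) (hole N w).
Proof.
move=> orb; have r0 : regular_fibre w := orb 0.
have r1 : regular_fibre (s w) := orb 1.
have := transfer_pullback1 N (phi N w) measurableT.
rewrite (rf_phi r0) fintZ// fint_fibre// (rf_normal r1 N) mulr1 => e.
rewrite /escape e [lambda 0 w * _]mulrC mulfK ?gt_eqF//.
have -> : fint (phi N w) (pullback1 N w setT) = fint (phi N w) (setT `\` hole N w).
  by apply: eq_fint => x Jx; split => -[].
rewrite fint_setD//; last exact: measurable_hole.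
by rewrite fint_fibre// (rf_normal r0) setTI subKr.
Qed.

Lemma fmass_le_phi w A : regular_fibre w -> measurable A ->
  fmass w A <= K * fint (phi 0 w) A.
Proof. by move=> r mA; apply: fmass_le => //; exact: rf_low r. Qed.

Lemma escape_le N w : regular_orbit w ->
  `|escape N w| <= K * K * hole_mu N w.
Proof.
move=> orb; have r0 : regular_fibre w := orb 0; have mH := measurable_hole N w.
rewrite escapeE// (le_trans (fint_bound mH (ltW K0) (rf_sup r0 N)))//.
by rewrite -mulrA ler_pM2l//; exact: fmass_le_phi.
Qed.

Lemma escape_scaled_le N w : regular_orbit w ->
  `|N%:R * escape N w| <= K * K * K.
Proof.
move=> orb; case: N => [|N]; first by rewrite mul0r normr0 !mulr_ge0// ltW.
rewrite normrM ger0_norm// mulrC -ler_pdivlMr ?ltr0n//.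
rewrite (le_trans (escape_le N.+1 orb))// -[leRHS]mulrA ler_pM2l ?mulr_gt0//.
exact: rf_hole (orb 0) N.+1 (ltn0Sn N).
Qed.

Lemma cvg_escape w : regular_orbit w -> escape ^~ w @ \oo --> (0 : R).
Proof.
move=> orb; apply/norm_cvg0P; apply: (squeeze_cvgr _ (cvg_cst 0) (cvg_invn (K * K * K))).
exists 1%N => // N /= N0; rewrite normr_ge0/= ler_pdivlMr ?ltr0n// mulrC.
by have := escape_scaled_le N orb; rewrite normrM ger0_norm.
Qed.

Definition lambda_ratio N n w : R :=
  \prod_(j < n) (lambda 0 (iter j s w) / lambda N (iter j s w)).

Lemma lambda_ratio0 N w : lambda_ratio N 0 w = 1.
Proof. exact: big_ord0. Qed.

Lemma lambda_ratioS N n w : lambda_ratio N n.+1 w =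
  lambda_ratio N n w * (lambda 0 (iter n s w) / lambda N (iter n s w)).
Proof. exact: big_ord_recr. Qed.

Lemma cvg_lambda_ratio n w : regular_orbit w ->
  (fun N => lambda_ratio N n w) @ \oo --> (1 : R).
Proof.
move=> orb; elim: n => [|n IH].
  by under eq_fun do rewrite lambda_ratio0; exact: cvg_cst.
rewrite (_ : (fun N => lambda_ratio N n.+1 w) =
    (fun N => lambda_ratio N n w * (1 - escape N (iter n s w))^-1)); last first.
  by apply/funext => N; rewrite /escape subKr invf_div lambda_ratioS.
rewrite -[X in _ --> X]mulr1; apply: cvgM => //.
rewrite -[X in _ --> X]invr1; apply: cvgV; first exact: oner_neq0.
rewrite -[X in _ --> X]subr0; apply: cvgB; first exact: cvg_cst.
exact/cvg_escape/regular_orbit_iter.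
Qed.

(** The [n]-fold composition of [C3], integrated over [A]. After the first step
    the [nu_N]-term vanishes because [nu_N] is zero on the range of [Q], and the
    [phi_N]-term is reproduced because [phi_N] is an eigenfunction. *)
Lemma Q_iter_fint n N w (f : B S w) A : regular_orbit w -> measurable A ->
  fint (op_iter (Q N) n.+1 f) A =
  lambda_ratio N n.+1 w * fint f (pullback N n.+1 w A)
  - nu_int N f * fint (phi N (iter n.+1 s w)) A.
Proof.
move=> orb mA0; move: A mA0.
have step v (g : B S v) C : regular_fibre v -> measurable C ->
    fint (Q N g) C = lambda 0 v / lambda N v * fint g (pullback1 N v C)
    - nu_int N g * fint (phi N (s v)) C.
  move=> rv mC; have := congr1 (fun h => fint h C) (rf_split rv N g).
  rewrite fintZ// fint_lin// transfer_pullback1// mulrA [_^-1 * _]mulrC => ->.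
  by rewrite addrC addKr.
elim: n => [|n IH] A mA.
  by rewrite lambda_ratioS lambda_ratio0 mul1r/= step//; exact: (orb 0).
have mp := measurable_pullback1 N (iter n.+1 s w) mA.
have := step (iter n.+1 s w) (op_iter (Q N) n.+1 f) A (orb n.+1) mA.
rewrite -[fint (Q N _) A]/(fint (op_iter (Q N) n.+2 f) A) => ->.
rewrite (_ : nu_int N (op_iter (Q N) n.+1 f) = 0) ?mul0r; last exact: rf_Q (orb n) N _.
rewrite subr0 IH//.
rewrite (lambda_ratioS N n.+1) mulrBr; congr (_ - _).
  by rewrite mulrCA mulrA; exact: erefl.
rewrite mulrCA; congr (_ * _).
have := transfer_pullback1 N (phi N (iter n.+1 s w)) mA.
rewrite (rf_phi (orb n.+1)) fintZ// [lambda 0 _ / _]mulrC -mulrA => <-.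
by rewrite mulKf// gt_eqF.
Qed.

Lemma pullback_fmass_le n N w A : regular_fibre w -> measurable A ->
  fmass w (pullback N n w A) <= K * fint (phi 0 (iter n s w)) A.
Proof.
move=> rw mA; have mP k := measurable_pullback k n w mA.
rewrite (le_trans (fmass_le_phi rw (mP N)))// ler_pM2l// -fint_phi_invariant_iter//.
rewrite (_ : fint _ (pullback N n w A) = fint (phi 0 w) (pullback N n w A `&` J w)).
  rewrite [leRHS](_ : _ = fint (phi 0 w) (pullback 0 n w A `&` J w)).
    apply: le_fint_phi; [exact: measurable_fibreI|exact: measurable_fibreI|].
    move=> x [/(pullbackP _ _ _ _)+ Jx] => /(_ Jx)[Ax _]; split => //.
    by apply/(pullbackP _ _ _ Jx); split => // j _ [].
  by apply: eq_fint => x Jx; split => // -[].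
by apply: eq_fint => x Jx; split => // -[].
Qed.

(** Each step removes the preimage of one hole; its [nu_0]-mass is [O(1/N)] by
    comparison with the invariant measure. *)
Lemma survivor_fint_le n N w (f : B S w) (F : R) : regular_orbit w -> (0 < N)%N ->
  0 <= F -> (sup_norm f <= F%:E)%E ->
  `|fint f (pullback N n w setT) - nu_int 0 f| <= n%:R * (F * (K * (K / N%:R))).
Proof.
move=> orb N0 F0 fF; elim: n => [|n IH].
  by rewrite fint_fibre// subrr normr0 mul0r.
have mH := measurable_hole N (iter n s w).
have mP A : measurable A -> measurable (pullback N n w A).
  exact: measurable_pullback.
have -> : fint f (pullback N n.+1 w setT) =
    fint f (pullback N n w setT `\` pullback N n w (hole N (iter n s w))).
  apply: eq_fint => x Jx; rewrite /setD /mkset !(pullbackP _ _ _ Jx); split.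
    move=> [_ h]; split; first by split => // j jn; apply: h; exact: ltnW.
    by move=> [hx _]; exact: h n (ltnSn n) hx.
  move=> [[_ h] nh]; split => // j; rewrite ltnS leq_eqVlt => /predU1P[->|].
    by move=> hx; exact: nh.
  exact: h.
rewrite fint_setD; [|exact: mP|exact: mP].
rewrite setIidr; last exact: pullback_sub.
rewrite addrAC (le_trans (ler_normB _ _))// -natr1 mulrDl mul1r lerD//.
rewrite (le_trans (fint_bound (mP _ mH) F0 fF))// ler_wpM2l//.
rewrite (le_trans (pullback_fmass_le _ _ (orb 0) mH))// ler_pM2l//.
exact: rf_hole (orb n) N N0.
Qed.

Lemma cvg_survivor_fint n w (f : B S w) (F : R) : regular_orbit w ->
  0 <= F -> (sup_norm f <= F%:E)%E ->
  (fun N => fint f (pullback N n w setT)) @ \oo --> nu_int 0 f.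
Proof.
move=> orb F0 fF; apply/subr_cvg0/norm_cvg0P.
apply: (squeeze_cvgr _ (cvg_cst 0) (cvg_invn (n%:R * (F * (K * K))))).
exists 1%N => // N /= N0; rewrite normr_ge0/=.
by rewrite (le_trans (survivor_fint_le n orb N0 F0 fF))// !mulrA.
Qed.

Lemma fmass_setT_le w A : measurable A -> fmass w A <= 1.
Proof.
move=> mA; rewrite /fmass -lee_fin fineK; last first.
  by rewrite ge0_fin_numE// nu0_fin//; exact: measurable_fibreI.
rewrite -(nu0_setT w); apply: le_measure; rewrite ?inE//.
exact: measurable_fibreI.
Qed.

Section decay.
Context (w : Omega) (f : B S w) (b : nat -> R).
Hypothesis orb : regular_orbit w.
Hypothesis b_ge0 : forall n, 0 <= b n.
Hypothesis b0 : b @ \oo --> (0 : R).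
Hypothesis Qb : forall n N, (sup_norm (op_iter (Q N) n.+1 f) <= (b n)%:E)%E.
Context (F : R).
Hypothesis F_ge0 : 0 <= F.
Hypothesis fF : (sup_norm f <= F%:E)%E.

(** [nu_N f = int L_N^n f / lambda_N^n - int Q_N^n f], where for fixed [n] the
    first term tends to [nu_0 f] and the second is small uniformly in [N]. *)
Lemma cvg_nu_int : (fun N => nu_int N f) @ \oo --> nu_int 0 f.
Proof.
have H n (e : R) : 0 < e -> \forall N \near \oo,
    `|nu_int N f - (fun=> nu_int 0 f) n| <= b n + e.
  move=> e0; have cv : (fun N => lambda_ratio N n.+1 w *
      fint f (pullback N n.+1 w setT)) @ \oo --> nu_int 0 f.
    rewrite -[X in _ --> X]mul1r; apply: cvgM; first exact: cvg_lambda_ratio.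
    exact: cvg_survivor_fint fF.
  have /cvgrPdist_le/(_ _ e0) := cv; apply: filterS => N hN.
  have := Q_iter_fint n N f orb measurableT.
  rewrite [fint (phi N _) _]fint_fibre// (rf_normal (orb n.+1)) mulr1.
  have := fint_bound measurableT (b_ge0 n) (Qb n N).
  have := fmass_setT_le (iter n.+1 s w) measurableT => m1 h.
  move/(le_trans h): (ler_piMr (b_ge0 n) m1) => {}h qE; move: h hN; rewrite qE.
  move: (_ * fint _ _) (nu_int N f) (nu_int 0 f) (b n) => x y z c.
  by rewrite !ler_norml => /andP[? ?] /andP[? ?]; apply/andP; split; lra.
have [l cl cs] := cvg_double_limit b0 H.
by rewrite -(cvg_unique _ cs (cvg_cst _)).
Qed.

(** The case [A = setT] of the expansion, solved for the mass of survivors. *)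
Lemma survivor_fint_eq n N :
  fint f (pullback N n.+1 w setT) = (lambda_ratio N n.+1 w)^-1 *
    (nu_int N f + fint (op_iter (Q N) n.+1 f) setT).
Proof.
rewrite Q_iter_fint// [fint (phi N _) _]fint_fibre// (rf_normal (orb n.+1)) mulr1.
rewrite addrC subrK mulrA mulVf ?mul1r// /lambda_ratio.
by apply/prodf_neq0 => j _; rewrite mulf_neq0// ?invr_eq0 gt_eqF.
Qed.

End decay.

Section perturbation.
Context (C : R) (alpha : nat -> R).
Hypothesis C_gt0 : 0 < C.
Hypothesis alpha_ge0 : forall n, 0 <= alpha n.
Hypothesis alpha0 : alpha @ \oo --> (0 : R).
Context (w : Omega).
Hypothesis orb : forall n, regular_orbit (iter n (sigmaV S) w).
Hypothesis Qphi : forall j n N, (sup_norm (op_iter (Q N) n.+1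
  (phi 0 (iter j (sigmaV S) w))) <= (C * alpha n)%:E)%E.
Hypothesis hole_gt0 : forall N, (0 < N)%N -> 0 < hole_mu N w.
Hypothesis qhat_cvg : forall k, cvgn (fun N => qhat S k N w).

(** The expansion of [phi_0] from the fibre over [sigma^-(n+1) w], integrated
    over the hole at [w] and divided by the [mu]-mass of that hole. *)
Lemma escape_expansion n N : (0 < N)%N ->
  `|lambda_ratio N n.+1 (iter n.+1 (sigmaV S) w) * (1 - \sum_(k < n.+1) qhat S k N w) -
    nu_int N (phi 0 (iter n.+1 (sigmaV S) w)) * (escape N w / hole_mu N w)| <=
  C * alpha n * K.
Proof.
move=> N0; set v := iter n.+1 (sigmaV S) w; have vw : iter n.+1 s v = w.
  exact: sigmaVK_iter.
have hN := hole_gt0 N0; have mH := measurable_hole N w.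
have := Q_iter_fint n N (phi 0 v) (orb n.+1) mH.
rewrite survivor_phi ?gt_eqF//.
have -> : fint (phi N (iter n.+1 s v)) (hole N w) = escape N w.
  by rewrite vw -escapeE//; exact: (orb 0).
have := fint_bound mH (mulr_ge0 (ltW C_gt0) (alpha_ge0 n)) (Qphi n.+1 n N).
have : fmass (iter n.+1 s v) (hole N w) <= K * hole_mu N w.
  by rewrite vw; apply: fmass_le_phi => //; exact: (orb 0 0).
move: (fmass _ _) (fint _ _) => a q aK qa qE.
rewrite (_ : _ - _ = q / hole_mu N w); last by rewrite qE; field; rewrite gt_eqF.
rewrite normrM normfV (gtr0_norm hN) ler_pdivrMr// (le_trans qa)//.
by rewrite -[leRHS]mulrA ler_wpM2l// mulr_ge0// ltW.
Qed.

(** For fixed [n], the eigenvalue ratios and [nu_N phi_0] tend to [1] and the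
    finitely many [qhat] converge, so [escape N w / hole_mu N w] is eventually
    within a constant times [alpha n] of the partial sum defining [theta0]. *)
Lemma cvg_escape_ratio :
  (fun N => escape N w / hole_mu N w) @ \oo --> theta0 S w.
Proof.
pose s_ n : R := 1 - \sum_(k < n.+1) qhat0 S k w.
have bn0 : (fun n => C * alpha n * K) @ \oo --> (0 : R).
  rewrite -[X in _ --> X](_ : C * 0 * K = 0); last by rewrite mulr0 mul0r.
  by apply: cvgM; [apply: cvgM => //; exact: cvg_cst|exact: cvg_cst].
have H n (e : R) : 0 < e -> \forall N \near \oo,
    `|escape N w / hole_mu N w - s_ n| <= C * alpha n * K + e.
  move=> e0; set v := iter n.+1 (sigmaV S) w; have rv := orb n.+1.
  have cnu : (fun N => nu_int N (phi 0 v)) @ \oo --> (1 : R).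
    rewrite -[X in _ --> X](rf_normal (rv 0) 0).
    apply: (@cvg_nu_int v (phi 0 v) (fun k => C * alpha k) _ _ _ _ K) => //.
    - by move=> k; rewrite mulr_ge0// ltW.
    - by rewrite -[X in _ --> X](mulr0 C); apply: cvgM => //; exact: cvg_cst.
    - exact: Qphi.
    - exact: ltW.
    - exact: rf_sup (rv 0) 0.
  have cS : (fun N => lambda_ratio N n.+1 v * (1 - \sum_(k < n.+1) qhat S k N w))
      @ \oo --> s_ n.
    rewrite -[X in _ --> X]mul1r; apply: cvgM; first exact: cvg_lambda_ratio.
    apply: cvgB; first exact: cvg_cst.
    by apply: cvg_big => [|k _]; [exact: add_continuous|exact: qhat_cvg].
  have cu : (fun N => K * K * `|1 - nu_int N (phi 0 v)| +
      `|lambda_ratio N n.+1 v * (1 - \sum_(k < n.+1) qhat S k N w) - s_ n|)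
      @ \oo --> (0 : R).
    rewrite -[X in _ --> X](_ : K * K * `|1 - 1| + 0 = 0); last first.
      by rewrite subrr normr0 mulr0 addr0.
    apply: cvgD; last by apply/norm_cvg0P/subr_cvg0.
    apply: cvgM; first exact: cvg_cst.
    by apply: cvg_norm; apply: cvgB => //; exact: cvg_cst.
  have /cvgr0_norm_le/(_ _ e0) := cu; apply: filterS2 (nbhs_infty_gt 0) => N N0.
  have hN := hole_gt0 N0.
  have rK : `|escape N w / hole_mu N w| <= K * K.
    by rewrite normrM normfV (gtr0_norm hN) ler_pdivrMr//; exact: escape_le (orb 0).
  have := escape_expansion n N0; rewrite -/v.
  move: (escape N w / hole_mu N w) (nu_int N _) rK => r nu1 rK.
  move: (lambda_ratio _ _ _ * _) (s_ n) (C * alpha n * K) => l s1 c h1 h2.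
  have h3 : `|r * (1 - nu1)| <= K * K * `|1 - nu1| by rewrite normrM ler_wpM2r.
  have {}h2 := le_trans (ler_norm _) h2.
  have -> : r - s1 = r * (1 - nu1) - (l - nu1 * r) + (l - s1) by ring.
  rewrite (le_trans (ler_normD _ _))//.
  have := ler_normB (r * (1 - nu1)) (l - nu1 * r).
  move: h1 h2 h3; move: (`|r * (1 - nu1) - _|) (`|l - s1|) (`|l - _|) (`|r * _|).
  by move: (K * K * `|_|) => x1 x2 x3 x4 x5 ? ? ? ?; lra.
have [l cl cs] := cvg_double_limit bn0 H.
suff -> : theta0 S w = l by [].
rewrite /theta0; suff -> : limn (series (fun k => qhat0 S k w)) = 1 - l by rewrite subKr.
suff cser : series (fun k => qhat0 S k w) @ \oo --> 1 - l by exact: (cvg_lim _ cser).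
rewrite -cvg_shiftS (_ : [sequence _]_n = (fun n => 1 - s_ n)).
  by apply: cvgB => //; exact: cvg_cst.
by apply/funext => n; rewrite /s_ subKr /series /= big_mkord.
Qed.

End perturbation.

(** [survivor_fint_eq] at time [N]: the inverse of [lambda_ratio] is the product
    of the [1 - escape N], governed by the averages of [N * escape N]. *)
Lemma cvg_survivor_mass w (f : B S w) (b : nat -> R) (F c : R) :
  regular_orbit w -> (forall n, 0 <= b n) -> b @ \oo --> (0 : R) ->
  (forall n N, (sup_norm (op_iter (Q N) n.+1 f) <= (b n)%:E)%E) ->
  0 <= F -> (sup_norm f <= F%:E)%E ->
  N%:R^-1 * \sum_(j < N) N%:R * escape N (iter j s w) @[N --> \oo] --> c ->
  (fun N => fint f (pullback N N w setT)) @ \oo --> expR (- c) * nu_int 0 f.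
Proof.
move=> orb b_ge0 b0 Qb F0 fF avg.
have cp : (fun N => (lambda_ratio N N w)^-1) @ \oo --> expR (- c).
  have xK N j : (j < N)%N -> `|N%:R * escape N (iter j s w)| <= K * K * K.
    by move=> _; exact: escape_scaled_le (regular_orbit_iter j orb).
  have := cvg_prod_expR (x := fun N j => N%:R * escape N (iter j s w)) xK avg.
  apply: cvg_trans; apply: near_eq_cvg; exists 1%N => // N /= N0.
  rewrite /lambda_ratio -prodfV; apply: eq_bigr => j _.
  rewrite [N%:R * _]mulrC mulfK ?pnatr_eq0 -?lt0n//.
  by rewrite /escape subKr invf_div.
rewrite -cvg_shiftS.
have cq : (fun N => fint (op_iter (Q N.+1) N.+1 f) setT) @ \oo --> (0 : R).
  apply/norm_cvg0P; apply: (squeeze_cvgr _ (cvg_cst 0) b0).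
  apply: nearW => N; rewrite normr_ge0/=.
  rewrite (le_trans (fint_bound measurableT (b_ge0 N) (Qb N N.+1)))//.
  by rewrite ler_piMr// fmass_setT_le.
rewrite [X in X @ _ --> _](_ : _ = fun N => (lambda_ratio N.+1 N.+1 w)^-1 *
    (nu_int N.+1 f + fint (op_iter (Q N.+1) N.+1 f) setT)); last first.
  by apply/funext => N; apply: survivor_fint_eq.
apply: cvgM; first by rewrite (cvg_shiftS (fun N => (lambda_ratio N N w)^-1)).
rewrite -[X in _ --> X]addr0; apply: cvgD => //.
by rewrite (cvg_shiftS (fun N => nu_int N f)); exact: cvg_nu_int Qb _ F0 fF.
Qed.

End regular.

Lemma nu0_fint w A : measurable A -> A `<=` J w -> nu0 w A = (fint (one w) A)%:E.
Proof.
move=> mA AJ; rewrite /fint setIidl//.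
rewrite (_ : \int[nu0 w]_(x in A) ev S (one w) x = \int[nu0 w]_(x in A) 1); last first.
  by apply: eq_Rintegral => x; rewrite inE => /AJ Jx; exact: cs_one hclosed w x Jx.
by rewrite Rintegral_cst// mul1r fineK// ge0_fin_numE// nu0_fin.
Qed.

Lemma sup_norm_one w : (sup_norm (one w) <= 1%:E)%E.
Proof.
rewrite /sup_norm unlock /Lnorm nu0_setT lte01; apply/ess_supP.
exists (~` J w); split; first by apply: measurableC; exact: measurable_fibre.
  exact: (cs_nu_prob hclosed w).2.
move=> x /= nx Jx; apply: nx; rewrite lee_fin.
by rewrite (cs_one hclosed Jx) normr1.
Qed.

Lemma below_thresholdE N w : (0 < N)%N ->
  below_threshold S N w = pullback N N w setT `&` J w.
Proof.
case: N => // N _; apply/seteqP; split => x.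
  move=> [Jx h]; split => //; apply/(pullbackP _ _ _ Jx); split => // j jN.
  by move=> [_ /=]; rewrite subr_gt0 ltNge h.
move=> [/(pullbackP _ _ _ _)+ Jx] => /(_ Jx)[_ h]; split => // j jN.
rewrite leNgt; apply/negP => hj; apply: (h j jN); split.
  exact: fibre_iter.
by rewrite /= subr_gt0.
Qed.

End fibres.

(** * Almost sure statements and the limit law *)

Lemma measure_preserving_inverse (R : realType) (d : measure_display)
    (Omega : measurableType d) (m : probability Omega R) (s sV : Omega -> Omega) :
  cancel s sV -> measurable_fun setT sV ->
  measure_preserving m s -> measure_preserving m sV.
Proof.
move=> sK msV [ms mps]; split => // A mA.
have mVA : measurable (sV @^-1` A) by rewrite -[X in measurable X]setTI; exact: msV.
rewrite -(mps _ mVA); congr (m _); apply/seteqP; split => w; by rewrite /preimage /= sK.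
Qed.

Lemma Lfun_infty_bounded (R : realType) (d : measure_display)
    (Omega : measurableType d) (m : probability Omega R) (t : Omega -> R) :
  t \in Lfun m +oo%E -> exists K : R, \forall w \ae m, `|t w| <= K.
Proof.
move=> /andP[_]; rewrite inE /= /finite_norm unlock /Lnorm.
rewrite ifT; last first.
  by rewrite [X in (_ < X)%E](_ : _ = 1%E) ?lte01//; exact: probability_setT.
exact: (@ess_supr_bounded _ _ _ m (Num.norm \o t)).
Qed.

Section assembly.
Context (R : realType) (d : measure_display) (Omega : measurableType d).
Context (m : probability Omega R) (X : completeMetricType R).
Context (S : open_system Omega X).
Context (Q : nat -> forall w, B S w -> B S (sigma S w)).
Context (t : Omega -> R) (xi : nat -> Omega -> R).
Hypothesis hclosed : closed_system m S.
Hypothesis hobs : observations m S.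
Hypothesis hopen : open_holes m S.
Hypothesis hC2 : C2 m S.
Hypothesis hC3 : C3 m Q.
Hypothesis hC4 : C4' m Q.
Hypothesis hC5 : C5' m S.
Hypothesis hC7 : C7' m S.
Hypothesis hC8 : C8 m S.
Hypothesis hS : scaling m S t xi.

Let lambda_gt0 N w : 0 < lambda S N w.
Proof. exact: c2_lambda_gt0 (hC2 N) w. Qed.

Let s_mp : measure_preserving m (sigma S) := cs_sigma_mp hclosed.

Let sV_mp : measure_preserving m (sigmaV S).
Proof.
exact: measure_preserving_inverse (cs_sigmaK hclosed) (cs_sigmaV_meas hclosed) s_mp.
Qed.

Lemma ae_hole_mu :
  \forall w \ae m, forall N, (0 < N)%N -> hole_mu S N w = (t w + xi N w) / N%:R.
Proof.
apply: filterS (sc_mu hS) => w h N N0; apply: EFin_inj.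
rewrite -[LHS](mu_fint hclosed w (measurable_hole hclosed hopen N w)).
by have := h N N0; case: N N0 {h}.
Qed.

Lemma ae_phi0_ge : exists2 K, 1 <= K &
  \forall w \ae m, forall x, J S w x -> K^-1 <= ev S (phi S 0 w) x.
Proof.
have [K K1 [N _ /(_ N (leqnn N))[/ess_infP h _]]] := hC7; exists K => //.
apply: filterS h => w hw x Jx; rewrite -lee_fin (le_trans hw)//.
by apply: ereal_inf_lbound; exists x.
Qed.

Lemma ae_regular_fibre : exists2 K, 1 <= K & \forall w \ae m, regular_fibre Q K w.
Proof.
have [K5 K5_1 ae5] := hC5.
have [K7 K7_1 ae_low] := ae_phi0_ge.
have [W aeW] := sc_xi_bound hS.
have [Kt aet] := Lfun_infty_bounded (sc_t hS).
pose K := K5 + K7 + `|Kt| + `|W|.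
have [K1 [K5K [K7K KtK]]] : 1 <= K /\ K5 <= K /\ K7 <= K /\ Kt + W <= K.
  have := normr_ge0 Kt; have := normr_ge0 W; rewrite /K.
  have := ler_norm Kt; have := ler_norm W.
  by move: `|W| `|Kt| K5_1 K7_1 => x y; lra.
exists K => //.
have ae2 : \forall w \ae m, forall N,
    L S N w (phi S N w) = lambda S N w *: phi S N (sigma S w).
  by apply/ae_foralln => N; exact: c2_phi (hC2 N).
have aen : \forall w \ae m, forall N,
    nu_int 0 (phi S N w) = 1 /\ nu_int 0 (Defs.one S w) = 1.
  by apply/ae_foralln => N; exact: c2_normal (hC2 N).
have ae3 : \forall w \ae m, forall N (f : B S w),
    [/\ (lambda S N w)^-1 *: L S N w f = nu_int N f *: phi S N (sigma S w) + Q N f,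
      Q N (phi S N w) = 0 & nu_int N (Q N f) = 0].
  by apply/ae_foralln => N; exact: hC3.
near=> w.
have [sup5 norm5] : (forall N, (sup_norm (phi S N w) <= K5%:E)%E) /\ `|phi S 0 w| <= K5.
  by near: w.
have t_le : `|t w| <= Kt by near: w.
have xi_le : forall N, (0 < N)%N -> `|xi N w| <= W by near: w.
have low : forall x, J S w x -> K7^-1 <= ev S (phi S 0 w) x by near: w.
have hw : forall N, (0 < N)%N -> hole_mu S N w = (t w + xi N w) / N%:R.
  by near: w; exact: ae_hole_mu.
have normal : forall N, nu_int 0 (phi S N w) = 1 /\ nu_int 0 (Defs.one S w) = 1.
  by near: w.
have split3 : forall N (f : B S w),
    [/\ (lambda S N w)^-1 *: L S N w f = nu_int N f *: phi S N (sigma S w) + Q N f,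
      Q N (phi S N w) = 0 & nu_int N (Q N f) = 0].
  by near: w.
split.
- by near: w.
- by move=> N; have [] := normal N.
- by have [] := normal 0%N.
- by move=> N f; have [] := split3 N f.
- by move=> N f; have [] := split3 N f.
- by move=> N; rewrite (le_trans (sup5 N))// lee_fin.
- exact: le_trans norm5 K5K.
- move=> x /low; apply: le_trans; rewrite lef_pV2 ?posrE//.
  + exact: lt_le_trans ltr01 K1.
  + exact: lt_le_trans ltr01 K7_1.
- move=> N N0; rewrite hw// ler_pM2r ?invr_gt0 ?ltr0n//.
  rewrite (le_trans _ KtK)// lerD//; first exact: le_trans (ler_norm _) t_le.
  exact: le_trans (ler_norm _) (xi_le N N0).
Unshelve. all: by end_near. Qed.

(** The scaling makes the mass positive only for large [N]; the holes are
    nested, so it is positive for all [N]. Hence almost every fibre is in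
    [Omega_plus]. *)
Lemma ae_hole_mu_gt0 :
  \forall w \ae m, forall N, (0 < N)%N -> 0 < hole_mu S N w.
Proof.
near=> w => N N0.
have hw : forall N, (0 < N)%N -> hole_mu S N w = (t w + xi N w) / N%:R.
  by near: w; exact: ae_hole_mu.
have t0 : 0 < t w by near: w; exact: sc_t_gt0 hS.
have xi0 : xi^~ w @ \oo --> (0 : R) by near: w; exact: sc_xi_cvg hS.
have [M _ hM] := cvgr0_norm_lt _ xi0 _ t0.
have M0 : (0 < maxn M N)%N by rewrite (leq_trans N0)// leq_maxr.
apply: (@lt_le_trans _ _ (hole_mu S (maxn M N) w)).
  rewrite hw// divr_gt0 ?ltr0n//.
  have := hM (maxn M N) (leq_maxl _ _); rewrite ltr_norml => /andP[].
  by move: (xi _ w) => z; lra.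
have mH k := measurable_hole hclosed hopen k w.
apply: (le_fint_phi hclosed w (mH (maxn M N)) (mH N)).
move=> x; have := ob_thr_incr hobs w N0 (leq_maxr M N).
case: (maxn M N) M0 => // k _; case: N N0 => // k' _ thr_le [Jx h].
by split => //; move: h; rewrite /= !subr_gt0; exact: le_lt_trans.
Unshelve. all: by end_near. Qed.

Section with_bound.
Context (K : R).
Hypothesis K1 : 1 <= K.
Hypothesis ae_reg : \forall w \ae m, regular_fibre Q K w.

Let K_gt0 : 0 < K. Proof. exact: lt_le_trans ltr01 K1. Qed.

Let ae_orb :
  \forall w \ae m, forall n, regular_orbit Q K (iter n (sigmaV S) w).
Proof. exact: (ae_iter sV_mp (ae_iter s_mp ae_reg)). Qed.

(** [C4'] reindexed to start at [0]; summability makes [alpha] tend to [0]. *)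
Lemma ae_Q_decay (f : forall w, B S w) : exists C : R, exists alpha : nat -> R,
  [/\ 0 < C, forall n, 0 <= alpha n, alpha @ \oo --> (0 : R) &
    \forall w \ae m, forall n N,
      (sup_norm (op_iter (Q N) n.+1 (f w)) <= (C * alpha n * `|f w|)%:E)%E].
Proof.
have [C [alpha [C0 alpha0 alpha_cvg Qf]]] := hC4 f.
exists C, (fun n => alpha n.+1); split => //.
- by move=> n; apply/ltW/alpha0.
- by rewrite cvg_shiftS; exact: cvg_series_cvg_0.
- by apply: filterS Qf => w Qf n N; exact: Qf.
Qed.

Lemma ae_cvg_escape :
  \forall w \ae m, (fun N => N%:R * escape S N w) @ \oo --> t w * theta0 S w.
Proof.
have [C [alpha [C0 alpha_ge0 alpha0 Qphi]]] := ae_Q_decay (phi S 0).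
have {}Qphi := ae_iter sV_mp Qphi.
near=> w.
have hw : forall N, (0 < N)%N -> hole_mu S N w = (t w + xi N w) / N%:R.
  by near: w; exact: ae_hole_mu.
have hw0 : forall N, (0 < N)%N -> 0 < hole_mu S N w.
  by near: w; exact: ae_hole_mu_gt0.
have xi0 : xi^~ w @ \oo --> (0 : R) by near: w; exact: sc_xi_cvg hS.
have orb : forall n, regular_orbit Q K (iter n (sigmaV S) w) by near: w.
have qw : Omega_plus S w -> forall k, cvgn (fun N => qhat S k N w).
  by near: w; exact: hC8.
have Qw : forall j n N, (sup_norm (op_iter (Q N) n.+1 (phi S 0 (iter j (sigmaV S) w))) <=
    (C * alpha n * `|phi S 0 (iter j (sigmaV S) w)|)%:E)%E.
  by near: w.
have wp : Omega_plus S w.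
  move=> N N0; have mH := measurable_hole hclosed hopen N w.
  by rewrite (mu_fint hclosed w mH) lte_fin; exact: hw0.
have rat : (fun N => escape S N w / hole_mu S N w) @ \oo --> theta0 S w.
  apply: (@cvg_escape_ratio _ _ _ m _ S hclosed hopen Q K K1 lambda_gt0
    (C * K) alpha _ alpha_ge0 alpha0 w orb _ hw0 (qw wp)).
    by rewrite mulr_gt0.
  move=> j n N; rewrite (le_trans (Qw j n N))// lee_fin [leRHS]mulrAC.
  by rewrite ler_wpM2l ?mulr_ge0 ?(ltW C0)//; exact: rf_norm (orb j 0%N).
have tN : (fun N => t w + xi N w) @ \oo --> t w.
  by rewrite -[X in _ --> X]addr0; apply: cvgD => //; exact: cvg_cst.
apply: cvg_trans (cvgM tN rat); apply: near_eq_cvg.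
exists 1%N => // N /= N0; have NR : N%:R != 0 :> R by rewrite pnatr_eq0 -lt0n.
have tn : t w + xi N w = N%:R * hole_mu S N w by rewrite hw// mulrC divfK.
by rewrite tn /=; field; rewrite gt_eqF// hw0.
Unshelve. all: by end_near. Qed.

Lemma ae_cvg_escape_average : \forall w \ae m,
  N%:R^-1 * \sum_(i < N) (N%:R * escape S N (iter i (sigma S) w)) @[N --> \oo] -->
  \int[m]_v (t v * theta0 S v).
Proof.
apply: (birkhoff_seq_ae s_mp (cs_ergodic hclosed) (K := K * K * K) _ _ ae_cvg_escape).
  move=> N; apply: measurable_funM; first exact: measurable_cst.
  apply: measurable_funB; first exact: measurable_cst.
  apply: measurable_funM; first exact: c2_lambda_meas (hC2 N).
  (* The inverse of a positive measurable function, as [expR (- ln _)]. *)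
  rewrite (_ : (fun _ => _) = expR \o (fun w => - ln (lambda S 0 w))); last first.
    by apply/funext => w /=; rewrite expRN lnK// posrE.
  apply: measurableT_comp; first exact: measurable_expR.
  apply: measurable_funN; apply: measurableT_comp; first exact: measurable_ln.
  exact: c2_lambda_meas (hC2 0).
apply: filterS ae_orb => w /(_ 0%N) orb N _.
exact: (escape_scaled_le hclosed hopen K1 lambda_gt0 N orb).
Qed.

Lemma ae_cvg_survivor_mass (f : forall w, B S w) :
  (\forall w \ae m, exists2 F : R, 0 <= F & (sup_norm (f w) <= F%:E)%E) ->
  (\forall w \ae m, nu_int 0 (f w) = 1) ->
  \forall w \ae m, (fun N => fint (f w) (pullback S N N w setT)) @ \oo -->
    expR (- \int[m]_v (t v * theta0 S v)).
Proof.
move=> fF f1; have [C [alpha [C0 alpha_ge0 alpha0 Qf]]] := ae_Q_decay f.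
near=> w.
have [F F0 fFw] : exists2 F : R, 0 <= F & (sup_norm (f w) <= F%:E)%E by near: w.
rewrite -[X in _ --> X]mulr1 -[X in _ * X](_ : nu_int 0 (f w) = 1); last by near: w.
have orb : regular_orbit Q K (iter 0 (sigmaV S) w).
  by move: (0%N); near: w; exact: ae_orb.
apply: (cvg_survivor_mass hclosed hopen K1 lambda_gt0 orb
  (b := fun n => C * alpha n * `|f w|) _ _ _ F0 fFw).
- by move=> n; rewrite !mulr_ge0// ltW.
- rewrite -[X in _ --> X](_ : C * 0 * `|f w| = 0); last by rewrite mulr0 mul0r.
  by apply: cvgM; [apply: cvgM => //; exact: cvg_cst|exact: cvg_cst].
- by near: w.
- by near: w; exact: ae_cvg_escape_average.
Unshelve. all: by end_near. Qed.

End with_bound.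

Lemma cvg_survivor_EFin w (f : B S w) (c : R) (g : set X -> \bar R) :
  (forall A : set (borel X), measurable A -> A `<=` J S w -> g A = (fint f A)%:E) ->
  (fun N => fint f (pullback S N N w setT)) @ \oo --> c ->
  (fun N => g (below_threshold S N w)) @ \oo --> c%:E.
Proof.
move=> gf fc; have mP N : measurable (pullback S N N w setT `&` J S w : set (borel X)).
  apply: (measurable_fibreI hclosed); apply: (measurable_pullback hclosed hopen).
  exact: measurableT.
have gE N : (0 < N)%N -> g (below_threshold S N w) = (fint f (pullback S N N w setT))%:E.
  move=> N0; rewrite (below_thresholdE hclosed w N0) gf//.
  by congr (_%:E); apply: eq_fint => x Jx; split => // -[].
apply: cvg_EFin; first by exists 1%N => // N /= N0; rewrite gE.
apply: cvg_trans fc; apply: near_eq_cvg.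
by exists 1%N => // N /= N0; rewrite gE.
Qed.

End assembly.

Theorem theorem8 (R : realType) (d : measure_display)
    (Omega : measurableType d) (m : probability Omega R)
    (X : completeMetricType R) (S : open_system Omega X)
    (Q : nat -> forall w, B S w -> B S (sigma S w))
    (t : Omega -> R) (xi : nat -> Omega -> R)
    (hclosed : closed_system m S) (hobs : observations m S)
    (hopen : open_holes m S)
    (hC1 : C1' m S) (hC2 : C2 m S) (hC3 : C3 m Q) (hC4 : C4' m Q)
    (hC5 : C5' m S) (hC7 : C7' m S) (hC8 : C8 m S)
    (hS : scaling m S t xi) :
  \forall w \ae m,
    ((fun N => nu S 0 w (below_threshold S N w)) @ \oo -->
       (expR (- \int[m]_v (t v * theta0 S v)))%:E) /\
    ((fun N => mu S w (below_threshold S N w)) @ \oo -->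
       (expR (- \int[m]_v (t v * theta0 S v)))%:E).
Proof.
have [K K1 ae_reg] := ae_regular_fibre hclosed hopen hC2 hC3 hC5 hC7 hS.
have main := ae_cvg_survivor_mass hclosed hobs hopen hC2 hC4 hC8 hS K1 ae_reg.
have H1 : \forall w \ae m, (fun N => fint (Defs.one S w) (pullback S N N w setT)) @ \oo -->
    expR (- \int[m]_v (t v * theta0 S v)).
  apply: (main (Defs.one S)).
    by apply: nearW => w; exists 1; [exact: ler01|exact: (sup_norm_one hclosed)].
  by apply: filterS ae_reg => w; exact: rf_one.
have H2 : \forall w \ae m, (fun N => fint (phi S 0 w) (pullback S N N w setT)) @ \oo -->
    expR (- \int[m]_v (t v * theta0 S v)).
  apply: (main (phi S 0)).
    apply: filterS ae_reg => w rw; exists K; first exact: le_trans ler01 K1.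
    exact: rf_sup rw 0.
  by apply: filterS ae_reg => w rw; exact: rf_normal rw 0.
apply: filterS2 H1 H2 => w h1 h2; split.
  by apply: (cvg_survivor_EFin hclosed hopen) h1 => // A mA AJ; exact: (nu0_fint hclosed).
by apply: (cvg_survivor_EFin hclosed hopen) h2 => // A mA AJ; exact: (mu_fint hclosed).
Qed.
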